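(* Let $\mathcal{X}$ be a compact subset of $\mathbb{R}^{Jd}$, let $M$ be a Borel probability distribution on $\mathcal{X}$, let $G_0\in\mathbb{P}$, and let $\Pi$ be a prior (a probability distribution) on $\mathbb{P}$ with prior predictive distribution $H$, such that $G_0$ lies in the weak support of $\Pi$. Suppose that (i) $P_0(\{j\}\mid \mathbf{x}):=q_j(\mathbf{x};G_0)>0$ for every $j\in\{1,\dots,J\}$ and every $\mathbf{x}\in\mathcal{X}$; (ii) $\int_{\mathbb{R}^d}|\boldsymbol\beta|\,H(\mathrm{d}\boldsymbol\beta)<+\infty$. Then $\Pi$ is consistent at $G_0$, i.e. for every $\epsilon>0$, $\Pi_n\{G\in\mathbb{P}: d(\mathbf{q}(\cdot;G),\mathbf{q}(\cdot;G_0))>\epsilon\}\to 0$ almost surely under $\mathrm{P}^\infty_{(G_0,M)}$ as $n\to\infty$.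
   Context: Fix integers $J\ge 2$ and $d\ge1$, and let $\mathbf{C}=\{1,\dots,J\}$. Write $\mathbf{x}=(\mathbf{x}_1,\dots,\mathbf{x}_J)\in\mathbb{R}^{Jd}$ with $\mathbf{x}_j\in\mathbb{R}^d$. The multinomial logit kernels are $k_j(\mathbf{x},\boldsymbol\beta)=\exp(\mathbf{x}_j'\boldsymbol\beta)/\sum_{l\in\mathbf{C}}\exp(\mathbf{x}_l'\boldsymbol\beta)$ for $j\in\mathbf{C}$, $\boldsymbol\beta\in\mathbb{R}^d$. $\mathbb{P}$ denotes the space of Borel probability measures on $\mathbb{R}^d$ with the weak topology. For $G\in\mathbb{P}$, $q_j(\mathbf{x};G)=\int_{\mathbb{R}^d}k_j(\mathbf{x},\boldsymbol\beta)G(\mathrm{d}\boldsymbol\beta)$ and $\mathbf{q}(\mathbf{x};G)=(q_1(\mathbf{x};G),\dots,q_J(\mathbf{x};G))$, a point of the probability simplex in $\mathbb{R}^J$. The distance $d(\mathbf{q}_1,\mathbf{q}_2)=\int_{\mathcal{X}}|\mathbf{q}_1(\mathbf{x})-\mathbf{q}_2(\mathbf{x})|\,M(\mathrm{d}\mathbf{x})$, with $|\cdot|$ the Euclidean norm. The prior predictive distribution of $\Pi$ is $H(B)=\int_{\mathbb{P}}G(B)\,\Pi(\mathrm{d}G)$ for Borel $B\subset\mathbb{R}^d$. $G_0$ is in the weak support of $\Pi$ if every weak neighborhood of $G_0$ has positive $\Pi$-probability. Data: $(Y_i,\mathbf{X}_i)_{i\ge1}$ are i.i.d. with $\mathbf{X}_i\sim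 M$ and $\mathrm{P}(Y_i=j\mid\mathbf{X}_i=\mathbf{x})=q_j(\mathbf{x};G_0)$; their joint law is $\mathrm{P}^\infty_{(G_0,M)}$. With $\Lambda_n(G)=\prod_{i=1}^n q_{Y_i}(\mathbf{X}_i;G)/q_{Y_i}(\mathbf{X}_i;G_0)$, the posterior is $\Pi_n(A)=\int_A\Lambda_n(G)\Pi(\mathrm{d}G)/\int_{\mathbb{P}}\Lambda_n(G)\Pi(\mathrm{d}G)$. *)

(* Defs.v *)
From HB Require Import structures.
From mathcomp Require Import all_boot all_order all_algebra.
From mathcomp Require Import all_classical all_reals all_analysis giry.

Set Implicit Arguments.
Unset Strict Implicit.
Unset Printing Implicit Defensive.

Import Order.TTheory GRing.Theory Num.Def Num.Theory.
Import numFieldNormedType.Exports.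

Local Open Scope classical_set_scope.
Local Open Scope ring_scope.

Definition borel (T : ptopologicalType) := g_sigma_algebraType (@open T).

Section mnl.
Variables (R : realType) (J d : nat).

(* parameter space R^d : row vectors; covariate space R^{Jd} : J x d matrices,
   the j-th row of x is x_j (the label j in {1..J} is 'I_J = {0..J-1}) *)
Definition Beta := borel 'rV[R]_d.
Definition Cov := borel 'M[R]_(J, d).

Definition dotp (x : 'M[R]_(J, d)) (j : 'I_J) (b : 'rV[R]_d) : R :=
  \sum_(k < d) x j k * b ord0 k.

Definition mnl_kernel (j : 'I_J) (x : 'M[R]_(J, d)) (b : 'rV[R]_d) : R :=
  expR (dotp x j b) / \sum_(l < J) expR (dotp x l b).

Definition enorm (b : 'rV[R]_d) : R := Num.sqrt (\sum_(k < d) b ord0 k ^+ 2).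

(* elements of P: (sub)probability measures with total mass 1 *)
Definition is_prob (G : giry Beta R) : Prop := G [set: Beta] = 1%E.

Definition q (j : 'I_J) (x : 'M[R]_(J, d)) (G : giry Beta R) : R :=
  fine (\int[G]_b (mnl_kernel j x b)%:E)%E.

Definition qdist (M : probability Cov R) (X : set Cov) (G1 G2 : giry Beta R) : R :=
  fine (\int[M]_(x in X)
          (Num.sqrt (\sum_(j < J) (q j x G1 - q j x G2) ^+ 2))%:E)%E.

(* G0 is in the weak support of Pi: every basic weak neighbourhood
   {G in P : |\int f_i dG - \int f_i dG0| < e, i < k}, f_i bounded continuous,
   has positive Pi-probability *)
Definition in_weak_support (Pi : giry (giry Beta R) R) (G0 : giry Beta R) : Prop :=
  forall (k : nat) (f : 'I_k -> 'rV[R]_d -> R) (e : R), 0 < e ->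
    (forall i, continuous (f i)) ->
    (forall i, exists C : R, forall b, `|f i b| <= C) ->
    (0 < Pi [set G : giry Beta R | is_prob G /\
       forall i, (`| fine (\int[G]_b (f i b)%:E)%E
                    - fine (\int[G0]_b (f i b)%:E)%E | < e)%R])%E.

Section data.
Variables (dO : measure_display) (Omega : measurableType dO).

(* (Y_i, X_i)_{i >= 0} i.i.d., X_i ~ M, P(Y_i = j | X_i = x) = q_j(x; G0):
   specified through the joint law on all finite-dimensional rectangles *)
Definition iid_mnl_data (P : probability Omega R) (M : probability Cov R)
    (G0 : giry Beta R) (Y : nat -> Omega -> 'I_J) (X : nat -> Omega -> Cov) : Prop :=
  [/\ forall i, measurable_fun [set: Omega] (X i),
      forall i (j : 'I_J), measurable [set w | Y i w = j] &
      forall (n : nat) (B : 'I_n -> set Cov) (js : 'I_n -> 'I_J),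
        (forall i, measurable (B i)) ->
        P (\bigcap_(i in [set: 'I_n]) [set w | B i (X i w) /\ Y i w = js i])
        = (\prod_(i < n) fine (\int[M]_(x in B i) (q (js i) x G0)%:E)%E)%:E].

Definition lik_ratio (G0 : giry Beta R) (Y : nat -> Omega -> 'I_J)
    (X : nat -> Omega -> Cov) (n : nat) (w : Omega) (G : giry Beta R) : R :=
  \prod_(i < n) (q (Y i w) (X i w) G / q (Y i w) (X i w) G0).

Definition posterior (Pi : giry (giry Beta R) R) (G0 : giry Beta R)
    (Y : nat -> Omega -> 'I_J) (X : nat -> Omega -> Cov) (n : nat) (w : Omega)
    (A : set (giry Beta R)) : R :=
  fine (\int[Pi]_(G in A) (lik_ratio G0 Y X n w G)%:E)%E
  / fine (\int[Pi]_G (lik_ratio G0 Y X n w G)%:E)%E.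

End data.
End mnl.

(* Main.v *)
Require Import Defs.
From HB Require Import structures.
From mathcomp Require Import all_boot all_order all_algebra.
From mathcomp Require Import all_classical all_reals all_analysis giry.
From mathcomp Require Import measurable_realfun ring lra.
Import Order.TTheory GRing.Theory Num.Def Num.Theory.
Import numFieldNormedType.Exports.
Local Open Scope classical_set_scope.
Local Open Scope ring_scope.
Set Implicit Arguments.
Unset Strict Implicit.
Unset Printing Implicit Defensive.

(** Since the kernels are positive and continuous, weak closeness of G to G0
    forces q(x; G) >= exp(-delta) q(x; G0) uniformly over the compact set X, so on
    a weak neighbourhood U of G0 the likelihood ratio is at least exp(-n delta)
    whatever the data, and the evidence is at least exp(-n delta) Pi(U).

    For the numerator, the kernels k(., beta) form a totally bounded subset of
    L1(M): any sequence beta_n has a subsequence along which every linear form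
    converges in [-oo, +oo], hence along which k(x, beta_n) converges for all x.
    Consequently finitely many tests phi : (j, x) -> [0, 1] separate from G0 all
    the G at distance more than e: the mean of phi under one of them exceeds its
    mean under G0 by e / 4.  On the set of G rejected by phi, a Chernoff bound
    with exp(- t phi) combined with Tonelli and summability shows that the
    integrated likelihood ratio decays almost surely at a geometric rate, faster
    than the evidence. *)

(** The obstacle is that [beta] ranges over an unbounded space, so mass of G may escape to infinity.
    The evidence asks only for a lower bound on q(x; G), so kernels can be cut off at large [beta];
    on the support of the cutoff a small move of x changes a kernel by a controlled factor, and a
    finite grid of covariates gives uniformity over X. The numerator allows no cutoff, since a
    distant G may sit anywhere; there the kernels that degenerate along diverging sequences are
    handled by their pointwise limits. The Chernoff exponent depends on G only through its mean of
    phi, so one bound serves all G rejected by the same test, whatever the prior does among them.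
    The law of the data is given on rectangles only, so every expectation of a product is first
    computed for simple functions. Budget of exponents, with eps the gap in the means: the two
    moment bounds together give eps^2/16, the two passages to almost sure bounds cost eps^2/64 each,
    and the evidence costs another eps^2/64; a rate eps^2/64 remains. *)

Lemma measurable_fun_invr_gt0 (d : measure_display) (T : measurableType d)
    (R : realType) (f : T -> R) :
  (forall x, 0 < f x) -> measurable_fun setT f ->
  measurable_fun setT (fun x => (f x)^-1).
Proof.
move=> f0 mf.
rewrite (_ : (fun x => _) = expR \o (fun x => - ln (f x))); last first.
  by apply/funext => x /=; rewrite expRN lnK// posrE.
apply: measurableT_comp; first exact: measurable_expR.
by apply: measurable_funN; apply: measurableT_comp => //; exact: measurable_ln.
Qed.

Lemma continuous_borel_measurable (R : realType) (T : ptopologicalType)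
    (f : T -> R) :
  continuous f -> measurable_fun [set: borel T] (f : borel T -> R).
Proof.
move=> cf; apply: (measurability _ (RGenOInfty.measurableE R)).
move=> _ [_ [a ->] <-]; rewrite setTI.
apply: sub_sigma_algebra; apply: open_comp; first by move=> x _; exact: cf.
exact: interval_open.
Qed.

Lemma measurable_coord (R : realType) (m n : nat) (i : 'I_m) (k : 'I_n) :
  measurable_fun [set: borel 'M[R]_(m, n)]
    ((fun x : 'M[R]_(m, n) => x i k) : borel 'M[R]_(m, n) -> R).
Proof. by apply: continuous_borel_measurable; exact: coord_continuous. Qed.

(* No measurability is required of the smaller function, nor of its domain. *)
Lemma ge0_le_integral_weak (d : measure_display) (T : measurableType d)
    (R : realType) (mu : {measure set T -> \bar R}) (D E : set T)
    (f g : T -> \bar R) :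
  (forall x, D x -> 0 <= f x)%E -> (forall x, E x -> 0 <= g x)%E ->
  (forall x, D x -> E x /\ f x <= g x)%E ->
  (\int[mu]_(x in D) f x <= \int[mu]_(x in E) g x)%E.
Proof.
move=> f0 g0 fg; rewrite (ge0_integralE mu f0) (ge0_integralE mu g0).
apply: le_ereal_sup => _ [h hf <-]; exists h => // x.
rewrite (le_trans (hf x))// /patch; case: ifPn => [/set_mem Dx|_].
  by have [Ex fgx] := fg _ Dx; rewrite mem_set.
by case: ifPn => // /set_mem /g0.
Qed.

(** * Logit kernels and choice probabilities: bounds and joint measurability *)

Section kernel.
Variables (R : realType) (J d : nat).
Implicit Types (j : 'I_J) (x y : 'M[R]_(J, d)) (b : 'rV[R]_d).
Implicit Types G : giry (Beta R d) R.

Lemma sum_expR_gt0 (j : 'I_J) (f : 'I_J -> R) : 0 < \sum_(l < J) expR (f l).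
Proof.
by rewrite (bigD1 j)//= ltr_pwDl ?expR_gt0// sumr_ge0// => l _; exact: expR_ge0.
Qed.

Lemma mnl_kernel_gt0 j x b : 0 < mnl_kernel j x b.
Proof. by rewrite divr_gt0// ?expR_gt0// (sum_expR_gt0 j). Qed.

Lemma sum_mnl_kernel x b (j : 'I_J) : \sum_(l < J) mnl_kernel l x b = 1.
Proof. by rewrite -mulr_suml divff// gt_eqF// (sum_expR_gt0 j). Qed.

Lemma mnl_kernel_le1 j x b : mnl_kernel j x b <= 1.
Proof.
rewrite -(sum_mnl_kernel x b j) (bigD1 j)//= lerDl sumr_ge0// => l _.
exact/ltW/mnl_kernel_gt0.
Qed.

Lemma mnl_kernelE j x b :
  mnl_kernel j x b = (\sum_(l < J) expR (dotp x l b - dotp x j b))^-1.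
Proof.
rewrite /mnl_kernel; under [in RHS]eq_bigr do rewrite expRD expRN.
by rewrite -mulr_suml invfM invrK mulrC.
Qed.

(** The inverse kernel is a sum of exponentials of differences of two utilities; each difference
    moves by at most [a + a]. *)
Lemma mnl_kernel_shift j x y b (a : R) :
  (forall l, `|dotp x l b - dotp y l b| <= a) ->
  expR (- (a + a)) * mnl_kernel j y b <= mnl_kernel j x b.
Proof.
move=> xy; rewrite !mnl_kernelE expRN -invfM.
have S0 z : 0 < \sum_(l < J) expR (dotp z l b - dotp z j b).
  exact: (sum_expR_gt0 j).
rewrite lef_pV2 ?posrE ?mulr_gt0 ?expR_gt0//.
rewrite mulr_sumr ler_sum// => l _; rewrite -expRD ler_expR.
have := xy l; have := xy j; rewrite !ler_norml => /andP[? ?] /andP[? ?].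
lra.
Qed.

Lemma measurable_mnl_kernel2 j :
  measurable_fun [set: Cov R J d * Beta R d]
    (fun z : Cov R J d * Beta R d => mnl_kernel j z.1 z.2).
Proof.
have mdot l : measurable_fun [set: Cov R J d * Beta R d]
    (fun z : Cov R J d * Beta R d => dotp z.1 l z.2).
  apply: measurable_sum => k; apply: measurable_funM.
    apply: (@measurableT_comp _ _ _ _ _ _ (fun x : Cov R J d => x l k)) => //.
    exact: measurable_coord.
  apply: (@measurableT_comp _ _ _ _ _ _ (fun b : Beta R d => b ord0 k)) => //.
  exact: measurable_coord.
have mexp l : measurable_fun [set: Cov R J d * Beta R d]
    (fun z : Cov R J d * Beta R d => expR (dotp z.1 l z.2)).
  by apply: measurableT_comp => //; exact: measurable_expR.
apply: measurable_funM => //; apply: measurable_fun_invr_gt0.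
  by move=> z; exact: (sum_expR_gt0 j).
exact: measurable_sum.
Qed.

Lemma measurable_mnl_kernel j x :
  measurable_fun [set: Beta R d] (mnl_kernel j x : Beta R d -> R).
Proof.
by apply: (measurable_fun_pair2 (x : Cov R J d) (measurable_mnl_kernel2 j)).
Qed.

Lemma measurable_mnl_kernel_cov j b :
  measurable_fun [set: Cov R J d] ((fun x => mnl_kernel j x b) : Cov R J d -> R).
Proof.
by apply: (measurable_fun_pair1 (b : Beta R d) (measurable_mnl_kernel2 j)).
Qed.

Lemma integral_mnl_kernel_ge0 j x G : (0 <= \int[G]_b (mnl_kernel j x b)%:E)%E.
Proof. by apply: integral_ge0 => b _; rewrite lee_fin ltW// mnl_kernel_gt0. Qed.

Lemma integral_mnl_kernel_le1 j x G : (\int[G]_b (mnl_kernel j x b)%:E <= 1)%E.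
Proof.
apply: (@le_trans _ _ (\int[G]_b (cst 1%E b))%E).
  apply: ge0_le_integral => //.
  - by move=> b _; rewrite lee_fin ltW// mnl_kernel_gt0.
  - apply/measurable_EFinP; exact: measurable_mnl_kernel.
  - by move=> b _; rewrite lee_fin mnl_kernel_le1.
by rewrite integral_cst//= mul1e sprobability_setT.
Qed.

Lemma qE j x G : (q j x G)%:E = (\int[G]_b (mnl_kernel j x b)%:E)%E.
Proof.
rewrite /q fineK// ge0_fin_numE ?integral_mnl_kernel_ge0//.
by rewrite (le_lt_trans (integral_mnl_kernel_le1 _ _ _))// ltry.
Qed.

Lemma q_ge0 j x G : 0 <= q j x G.
Proof. by rewrite -lee_fin qE integral_mnl_kernel_ge0. Qed.

Lemma q_le1 j x G : q j x G <= 1.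
Proof. by rewrite -lee_fin qE integral_mnl_kernel_le1. Qed.

Lemma sum_q x G (j : 'I_J) : is_prob G -> \sum_(l < J) q l x G = 1.
Proof.
move=> G1; apply: EFin_inj; rewrite -sumEFin.
under eq_bigr do rewrite qE.
rewrite -ge0_integral_sum//=; last 2 first.
  by move=> l; apply/measurable_EFinP; exact: measurable_mnl_kernel.
  by move=> l b _; rewrite lee_fin ltW// mnl_kernel_gt0.
under eq_integral do rewrite sumEFin (sum_mnl_kernel _ _ j).
by rewrite integral_cst//= mul1e.
Qed.

(** G is read as the measure attached to the parameter (x, G). This turns [q] into an integral
    against a finite kernel, whose joint measurability in (x, G) is what Tonelli over the prior
    requires. *)
Definition giry_kernel (z : Cov R J d * giry (Beta R d) R) :
  {measure set (Beta R d) -> \bar R} := z.2.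

Let measurable_giry_kernel U : measurable U ->
  measurable_fun setT (giry_kernel ^~ U).
Proof.
move=> mU.
by apply: (@measurableT_comp _ _ _ _ _ _ (giry_ev ^~ U)) => //; exact: measurable_giry_ev.
Qed.

HB.instance Definition _ := isKernel.Build _ _ _ _ _ giry_kernel
  measurable_giry_kernel.

Let giry_kernel_uub : measure_fam_uub giry_kernel.
Proof.
(* The uniform bound has to be strict and the total mass may equal 1, hence 2. *)
by exists 2 => z; rewrite (le_lt_trans (@sprobability_setT _ _ _ z.2))// lte_fin ltr1n.
Qed.

HB.instance Definition _ := Kernel_isFinite.Build _ _ _ _ _ giry_kernel
  giry_kernel_uub.

Lemma measurable_q2 j : measurable_fun [set: Cov R J d * giry (Beta R d) R]
  (fun z : Cov R J d * giry (Beta R d) R => q j z.1 z.2).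
Proof.
apply/measurable_EFinP.
pose k (y : (Cov R J d * giry (Beta R d) R) * Beta R d) :=
  (mnl_kernel j y.1.1 y.2)%:E.
rewrite (_ : _ \o _ = fun z => \int[giry_kernel z]_b k (z, b))%E; last first.
  by apply/funext => z /=; rewrite qE.
apply: (measurable_fun_integral_finite_kernel k giry_kernel).
  by move=> z; rewrite lee_fin ltW// mnl_kernel_gt0.
apply/measurable_EFinP.
apply: (@measurableT_comp _ _ _ _ _ _
  (fun z : Cov R J d * Beta R d => mnl_kernel j z.1 z.2) _
  (fun y : (Cov R J d * giry (Beta R d) R) * Beta R d => (y.1.1, y.2))).
  exact: measurable_mnl_kernel2.
apply: measurable_fun_pair => //.
by apply: (@measurableT_comp _ _ _ _ _ _ fst).
Qed.

Lemma measurable_q j G :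
  measurable_fun [set: Cov R J d] ((fun x => q j x G) : Cov R J d -> R).
Proof. exact: (measurable_fun_pair1 G (measurable_q2 j)). Qed.

Lemma measurable_is_prob : measurable [set G : giry (Beta R d) R | is_prob G].
Proof.
have := measurable_giry_ev (R := R) (@measurableT _ (Beta R d)) measurableT.
by move=> /(_ [set 1%E] (emeasurable_set1 _)); rewrite setTI.
Qed.

End kernel.

(** Labels are known to be measurable only through their level sets, so the composite is split into
    finitely many indicators instead of being treated as a composition. *)
Lemma measurable_fun_select (d : measure_display) (T : measurableType d)
    (R : realType) (J : nat) (y : T -> 'I_J) (f : 'I_J -> T -> R) :
  (forall j, measurable [set t | y t = j]) ->
  (forall j, measurable_fun setT (f j)) ->
  measurable_fun setT (fun t => f (y t) t).
Proof.
move=> my mf.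
rewrite (_ : (fun t => _) =
    fun t => \sum_(j < J) \1_[set t | y t = j] t * f j t); last first.
  apply/funext => t; rewrite (bigD1 (y t))//= big1 ?addr0.
    by rewrite indicE mem_set// mul1r.
  by move=> j jy; rewrite indicE memNset ?mul0r//= => /esym/eqP; rewrite (negbTE jy).
by apply: measurable_sum => j; exact: measurable_funM.
Qed.

Section approx_sum.
Context (d : measure_display) (T : measurableType d) (R : realType).
Variables (f : T -> \bar R) (mf : measurable_fun setT f).

(** [approx] is a dyadic sum plus a separate term for the values at least m. Giving that term the
    index [m * 2 ^ m] makes it one finite sum of weighted indicators. *)
Definition approx_coef (m k : nat) : R :=
  if (k < m * 2 ^ m)%N then k%:R * 2 ^- m else m%:R.

Definition approx_set (m k : nat) : set T :=
  if (k < m * 2 ^ m)%N then dyadic_approx setT f m k else integer_approx setT f m.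

Lemma approx_coef_ge0 m k : 0 <= approx_coef m k.
Proof. by rewrite /approx_coef; case: ifP. Qed.

Lemma measurable_approx_set m k : measurable (approx_set m k).
Proof.
rewrite /approx_set; case: ifPn => km.
  rewrite /dyadic_approx km -preimage_comp; apply: mf => //.
  by apply/measurable_image_EFin; exact: measurable_itv.
exact: emeasurable_fun_c_infty.
Qed.

Lemma approx_sumE m t : approx setT f m t =
  \sum_(k < (m * 2 ^ m).+1) approx_coef m k * \1_(approx_set m k) t.
Proof.
rewrite big_ord_recr/= /approx; congr (_ + _); last first.
  by rewrite /approx_coef /approx_set ltnn.
by apply: eq_bigr => k _; rewrite /approx_coef /approx_set ltn_ord.
Qed.

End approx_sum.

(** * Expectations of products along the i.i.d. data *)

Section data.
Context (R : realType) (J d : nat).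
Context (dO : measure_display) (Omega : measurableType dO).
Variables (P : probability Omega R) (M : probability (Cov R J d) R).
Variables (G0 : giry (Beta R d) R).
Variables (Y : nat -> Omega -> 'I_J) (X : nat -> Omega -> Cov R J d).
Hypothesis data : iid_mnl_data P M G0 Y X.

Lemma integral_q_fin (B : set (Cov R J d)) j : measurable B ->
  (\int[M]_(x in B) (q j x G0)%:E)%E \is a fin_num.
Proof.
move=> mB; rewrite ge0_fin_numE; last first.
  by apply: integral_ge0 => x _; rewrite lee_fin q_ge0.
apply: (@le_lt_trans _ _ (\int[M]_(x in B) cst 1%E x)%E).
  apply: ge0_le_integral => //.
  - by move=> x _; rewrite lee_fin q_ge0.
  - by apply/measurable_EFinP/measurable_funTS; exact: measurable_q.
  - by move=> x _; rewrite lee_fin q_le1.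
by rewrite integral_cst//= mul1e (le_lt_trans (probability_le1 _ _))// ltry.
Qed.

(** Expanding the product of sums gives indicators of rectangles, the only events whose probability
    is given; the resulting sum of products refolds into an n-th power. *)
Lemma integral_prod_simple (n N : nat) (c : 'I_N -> R)
    (B : 'I_J -> 'I_N -> set (Cov R J d)) :
  (forall k, 0 <= c k) -> (forall j k, measurable (B j k)) ->
  (\int[P]_w (\prod_(i < n) \sum_(k < N) c k * \1_(B (Y i w) k) (X i w))%:E =
   ((\sum_(j < J) \sum_(k < N)
       c k * fine (\int[M]_(x in B j k) (q j x G0)%:E)) ^+ n)%:E)%E.
Proof.
move=> c0 mB; have [mX mY PE] := data.
pose E i (p : 'I_J * 'I_N) := [set w | B p.1 p.2 (X i w) /\ Y i w = p.1].
have mE i p : measurable (E i p).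
  rewrite (_ : E i p = (X i @^-1` B p.1 p.2) `&` [set w | Y i w = p.1])//.
  by apply: measurableI => //; rewrite -[X in measurable X]setTI; exact: mX.
pose F (f : {ffun 'I_n -> 'I_J * 'I_N}) := \bigcap_(i in [set: 'I_n]) E i (f i).
have mF f : measurable (F f) by apply: fin_bigcap_measurable.
have -> : (fun w => (\prod_(i < n) \sum_(k < N) c k * \1_(B (Y i w) k) (X i w))%:E) =
   (fun w => \sum_(f : {ffun 'I_n -> 'I_J * 'I_N})
      (\prod_(i < n) c (f i).2)%:E * (\1_(F f) w)%:E)%E.
  apply/funext => w.
  under [RHS]eq_bigr do rewrite -EFinM; rewrite sumEFin; congr EFin.
  (* The label becomes a summation index, of which only j = Y_i(w) contributes. Distributing then
     produces one rectangle per choice of a pair (label, piece) for each i. *)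
  transitivity (\prod_(i < n) \sum_(p : 'I_J * 'I_N) c p.2 * \1_(E i p) w).
    apply: eq_bigr => i _.
    rewrite -(pair_bigA _ (fun j k => c k * \1_(E i (j, k)) w))/=.
    rewrite (bigD1 (Y i w))//= [X in _ + X]big1 ?addr0.
      apply: eq_bigr => k _; congr (_ * _); rewrite !indicE; congr (_%:R); congr nat_of_bool.
      by apply/idP/idP => /set_mem; [move=> ?; apply/mem_set|case=> ? _; apply/mem_set].
    move=> j jY; rewrite big1// => k _; rewrite indicE memNset ?mulr0//=.
    by case=> _ /esym/eqP; rewrite (negbTE jY).
  rewrite bigA_distr_bigA; apply: eq_bigr => f _.
  rewrite big_split/=; congr (_ * _).
  have [Fw|Fw] := pselect (F f w).
    rewrite indicE mem_set//= big1// => i _.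
    by rewrite indicE mem_set//; exact: Fw.
  rewrite [RHS]indicE memNset//=.
  have [i nEi] : exists i : 'I_n, ~ E i (f i) w.
    by apply/existsNP => H; apply: Fw => i _; exact: H.
  by rewrite (bigD1 i)//= indicE memNset// mul0r.
rewrite ge0_integral_sum//; last 2 first.
- move=> f; apply: measurable_funeM; apply/measurable_EFinP.
  exact: measurable_indic.
- by move=> f w _; rewrite mule_ge0// lee_fin ?prodr_ge0.
transitivity (\sum_(f : {ffun 'I_n -> 'I_J * 'I_N}) (\prod_(i < n)
   (c (f i).2 * fine (\int[M]_(x in B (f i).1 (f i).2) (q (f i).1 x G0)%:E)%E))%:E)%E.
  apply: eq_bigr => f _.
  rewrite ge0_integralZl//; last 2 first.
  - by apply/measurable_EFinP.
  - by rewrite lee_fin prodr_ge0.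
  rewrite integral_indic// setIT.
  have := PE n (fun i => B (f i).1 (f i).2) (fun i => (f i).1) (fun i => mB _ _).
  rewrite -/(F f) => PF; rewrite [X in (_ * X)%E](_ : _ = P (F f))//= PF.
  by rewrite -EFinM big_split.
rewrite sumEFin; congr EFin.
rewrite -(bigA_distr_bigA (fun (_ : 'I_n) (p : 'I_J * 'I_N) =>
   c p.2 * fine (\int[M]_(x in B p.1 p.2) (q p.1 x G0)%:E)%E)).
rewrite prodr_const card_ord; congr (_ ^+ _).
by rewrite pair_bigA.
Qed.

Lemma measurable_data (g : 'I_J -> Cov R J d -> R) i :
  (forall j, measurable_fun setT (g j)) ->
  measurable_fun setT (fun w => g (Y i w) (X i w)).
Proof.
have [mX mY _] := data => mg.
apply: (@measurable_fun_select _ _ _ _ _ (fun j w => g j (X i w))) => // j.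
exact: measurableT_comp.
Qed.

(** Increasing simple approximations of g carry the product formula from rectangles to nonnegative
    functions, by monotone convergence. Each approximation already satisfies the bound r, which
    therefore passes to the limit. *)
Lemma integral_prod_le (n : nat) (g : 'I_J -> Cov R J d -> R) (r : R) :
  (forall j, measurable_fun setT (g j)) -> (forall j x, 0 <= g j x) ->
  (\sum_(j < J) \int[M]_x (g j x * q j x G0)%:E <= r%:E)%E ->
  (\int[P]_w (\prod_(i < n) g (Y i w) (X i w))%:E <= (r ^+ n)%:E)%E.
Proof.
move=> mg g0 gr.
have mEg j : measurable_fun setT (EFin \o g j) by exact/measurable_EFinP.
pose h m j := approx setT (EFin \o g j) m.
have h0 m j x : 0 <= h m j x.
  rewrite /h approx_sumE sumr_ge0// => k _.
  by rewrite mulr_ge0 ?approx_coef_ge0.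
have hnd j x : {homo (fun m => h m j x) : m p / (m <= p)%N >-> m <= p}.
  by move=> m p mp; exact/lefP/nd_approx.
have mh m j : measurable_fun setT (h m j).
  rewrite (_ : h m j = fun x => \sum_(k < (m * 2 ^ m).+1)
     approx_coef R m k * \1_(approx_set (EFin \o g j) m k) x); last first.
    by apply/funext => x; exact: approx_sumE.
  apply: measurable_sum => k; apply: measurable_funM => //.
  exact/measurable_indic/measurable_approx_set.
have hg m j x : h m j x <= g j x.
  by rewrite -lee_fin; apply: (@le_approx _ _ _ _ (EFin \o g j)) => // *; rewrite lee_fin.
have hle m : (\int[P]_w (\prod_(i < n) h m (Y i w) (X i w))%:E <= (r ^+ n)%:E)%E.
  under eq_integral do under eq_bigr do rewrite /h approx_sumE.
  rewrite (@integral_prod_simple n (m * 2 ^ m).+1 (fun k => approx_coef R m k)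
    (fun j k => approx_set (EFin \o g j) m k)); last 2 first.
  - by move=> k; exact: approx_coef_ge0.
  - by move=> j k; exact: measurable_approx_set.
  have fin0 j k : 0 <= fine (\int[M]_(x in approx_set (EFin \o g j) m k) (q j x G0)%:E)%E.
    by apply: fine_ge0; apply: integral_ge0 => x _; rewrite lee_fin q_ge0.
  rewrite lee_fin lerXn2r ?nnegrE//.
  - rewrite sumr_ge0// => j _; rewrite sumr_ge0// => k _.
    by rewrite mulr_ge0 ?approx_coef_ge0.
  - rewrite -lee_fin (le_trans _ gr)// sume_ge0// => j _.
    by apply: integral_ge0 => x _; rewrite lee_fin mulr_ge0 ?q_ge0.
  - rewrite -lee_fin (le_trans _ gr)// -sumEFin lee_sum// => j _.
    apply: (@le_trans _ _ (\int[M]_x (h m j x * q j x G0)%:E)%E); last first.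
      apply: ge0_le_integral => //.
      + by move=> x _; rewrite lee_fin mulr_ge0 ?q_ge0.
      + by apply/measurable_EFinP; apply: measurable_funM => //; exact: measurable_q.
      + by apply/measurable_EFinP; apply: measurable_funM => //; exact: measurable_q.
      + by move=> x _; rewrite lee_fin ler_wpM2r ?q_ge0.
    have -> : (\int[M]_x (h m j x * q j x G0)%:E = \int[M]_x
       (\sum_(k < (m * 2 ^ m).+1) (approx_coef R m k)%:E *
        (fun x => (q j x G0)%:E) \_ (approx_set (EFin \o g j) m k) x))%E.
      apply: eq_integral => x _; rewrite /h approx_sumE mulr_suml -sumEFin.
      apply: eq_bigr => k _; rewrite -mulrA EFinM; congr (_ * _)%E.
      by rewrite patchE indicE; case: (x \in _); rewrite ?mul1r ?mul0r.
    have mp k : measurable_fun setT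
        ((fun x => (q j x G0)%:E) \_ (approx_set (EFin \o g j) m k)).
      apply/(measurable_restrictT _ (measurable_approx_set (mEg j) m k)).
      by apply/measurable_EFinP/measurable_funTS; exact: measurable_q.
    have p0 k x : (0 <= ((fun x => (q j x G0)%:E) \_ (approx_set (EFin \o g j) m k)) x)%E.
      by rewrite patchE; case: ifP => // _; rewrite lee_fin q_ge0.
    rewrite ge0_integral_sum//; last 2 first.
    - by move=> k; exact: measurable_funeM.
    - by move=> k x _; rewrite mule_ge0// lee_fin approx_coef_ge0.
    rewrite -sumEFin lee_sum// => k _.
    rewrite ge0_integralZl//; last by rewrite lee_fin approx_coef_ge0.
    by rewrite -integral_mkcond EFinM fineK// integral_q_fin//; exact: measurable_approx_set.
have ndE w : {homo (fun m => (\prod_(i < n) h m (Y i w) (X i w))%:E) :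
    m p / (m <= p)%N >-> (m <= p)%E}.
  by move=> m p mp; rewrite lee_fin ler_prod// => i _; rewrite h0 hnd.
have -> : (\int[P]_w (\prod_(i < n) g (Y i w) (X i w))%:E =
  \int[P]_w limn (fun m => (\prod_(i < n) h m (Y i w) (X i w))%:E))%E.
  apply: eq_integral => w _; apply/esym/cvg_lim => //.
  apply: cvg_EFin; first by apply: nearW.
  apply: cvg_big => [|i _]; first exact: mul_continuous.
    have := @cvg_approx _ _ _ setT (EFin \o g (Y i w)) (X i w).
  by apply => // *; rewrite ?lee_fin ?ltry.
rewrite monotone_convergence//; last 2 first.
- move=> m; apply/measurable_EFinP; apply: measurable_prod => i _.
  exact: measurable_data.
- by move=> m w _; rewrite lee_fin prodr_ge0.
apply: lime_le; last exact: nearW.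
apply: ereal_nondecreasing_is_cvgn => m p mp.
apply: ge0_le_integral => //.
- by move=> w _; rewrite lee_fin prodr_ge0.
- by apply/measurable_EFinP; apply: measurable_prod => i _; exact: measurable_data.
- by apply/measurable_EFinP; apply: measurable_prod => i _; exact: measurable_data.
- by move=> w _; exact: ndE.
Qed.

End data.

(** Inverting exp(-u) >= 1 - u gives exp(u) <= 1 / (1 - u); the quadratic times 1 - u exceeds 1 by
    u^2 (1 - 2 u), which is nonnegative for u <= 1/2. *)
Lemma expR_le_quadratic (R : realType) (u : R) :
  u <= 2^-1 -> expR u <= 1 + u + 2 * u ^+ 2.
Proof.
move=> u2; rewrite -[leLHS]invrK -expRN.
have h : 1 - u <= expR (- u) by exact: expR_ge1Dx.
have u0 : 0 < 1 - u by lra.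
rewrite (@le_trans _ _ (1 - u)^-1)//.
  by rewrite lef_pV2 ?posrE ?expR_gt0.
rewrite -[leLHS]mul1r ler_pdivrMr// -subr_ge0.
have -> : (1 + u + 2 * u ^+ 2) * (1 - u) - 1 = u ^+ 2 * (1 - 2 * u) by ring.
by rewrite mulr_ge0 ?sqr_ge0//; lra.
Qed.

Lemma bounded_integrable (d : measure_display) (T : measurableType d)
    (R : realType) (mu : {finite_measure set T -> \bar R}) (f : T -> R) (C : R) :
  measurable_fun setT f -> (forall x, `|f x| <= C) ->
  mu.-integrable setT (EFin \o f).
Proof.
move=> mf fC; apply: measurable_bounded_integrable => //.
  by rewrite ltey_eq fin_num_measure.
exists C; split; first exact: num_real.
by move=> y Cy x _ /=; rewrite (le_trans (fC x))// ltW.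
Qed.

(** Weighted by (th / r)^n, the functions have integrals at most th^n, so their series has a finite
    integral and is finite almost everywhere. Its sum is the constant C, which depends on the
    point. *)
Lemma ae_geometric_bound (d : measure_display) (T : measurableType d)
    (R : realType) (mu : {measure set T -> \bar R}) (f : nat -> T -> \bar R)
    (r th : R) : 0 < r -> 0 < th -> th < 1 ->
  (forall n, measurable_fun setT (f n)) -> (forall n t, (0 <= f n t)%E) ->
  (forall n, \int[mu]_t f n t <= (r ^+ n)%:E)%E ->
  {ae mu, forall t, exists2 C : R, 0 <= C &
     forall n, (f n t <= (C * (r / th) ^+ n)%:E)%E}.
Proof.
move=> r0 th0 th1 mf f0 fr.
pose c n : R := (th / r) ^+ n.
have c0 n : 0 < c n by rewrite exprn_gt0// divr_gt0.
pose g n t := ((c n)%:E * f n t)%E.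
have g0 n t : (0 <= g n t)%E by rewrite mule_ge0// lee_fin ltW.
have mg n : measurable_fun setT (g n) by exact: measurable_funeM.
have : mu.-integrable setT (fun t => \sum_(n <oo) g n t)%E.
  apply/integrableP; split.
    by apply: ge0_emeasurable_sum.
  under eq_integral do rewrite gee0_abs ?nneseries_ge0//.
  rewrite integral_nneseries//.
  apply: (@le_lt_trans _ _ ((1 - th)^-1)%:E); last exact: ltry.
  apply: lime_le.
    by apply: is_cvg_nneseries => n _ _; exact: integral_ge0.
  apply: nearW => n.
  apply: (@le_trans _ _ (\sum_(0 <= k < n) (th ^+ k)%:E)%E).
    apply: lee_sum => k _; rewrite ge0_integralZl//; last by rewrite lee_fin ltW.
    apply: (@le_trans _ _ ((c k)%:E * (r ^+ k)%:E)%E).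
      by rewrite lee_wpmul2l// lee_fin ltW.
    by rewrite -EFinM lee_fin /c expr_div_n divfK// gt_eqF// exprn_gt0.
  rewrite sumEFin lee_fin big_mkord.
  rewrite -[leRHS]mul1r ler_pdivlMr ?subr_gt0// mulrC.
  by rewrite -opprB mulNr -subrX1 opprB gerBl exprn_ge0// ltW.
move=> /integrable_ae => /(_ measurableT).
apply: filterS => t /(_ I) fin.
exists (fine (\sum_(n <oo) g n t)%E).
  by rewrite fine_ge0// nneseries_ge0.
move=> n; rewrite EFinM fineK//.
have : (g n t <= \sum_(n <oo) g n t)%E.
  apply: le_trans (nneseries_lim_ge n.+1 _) => //.
  by rewrite big_mkord big_ord_recr/= leeDr// sume_ge0.
rewrite -(@lee_pmul2l _ (c n)^-1%:E)// ?lte_fin ?invr_gt0// /g muleA -EFinM.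
rewrite mulVf ?gt_eqF// mul1e => /le_trans; apply.
by rewrite muleC /c -exprVn invf_div.
Qed.

(** * Expectations of tests and their moment generating functions *)

Section mean.
Context (R : realType) (J d : nat).
Variable M : probability (Cov R J d) R.
Implicit Types (phi : 'I_J -> Cov R J d -> R) (G : giry (Beta R d) R).

(** A positive function with zero integral would make G the null measure. *)
Lemma q_gt0 j (x : 'M[R]_(J, d)) G : is_prob G -> 0 < q j x G.
Proof.
move=> G1; rewrite lt_neqAle q_ge0 andbT; apply/eqP => q0.
have mk : measurable_fun setT (fun b : Beta R d => (mnl_kernel j x b)%:E).
  by apply/measurable_EFinP; exact: measurable_mnl_kernel.
have : (\int[G]_b `|(mnl_kernel j x b)%:E| = 0)%E.
  under eq_integral do rewrite gee0_abs ?lee_fin ?ltW ?mnl_kernel_gt0//.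
  by rewrite -qE -q0.
move/(ae_eq_integral_abs _ measurableT mk) => [N [mN N0 sN]].
suff : (G setT <= 0)%E by rewrite G1 lee_fin ler10.
rewrite -N0 le_measure ?inE// => b _; apply: sN => /= /(_ I) [] kb.
by have := mnl_kernel_gt0 j x b; rewrite kb ltxx.
Qed.

(* The expectation of phi(Y, X) when X ~ M and P(Y = j | X = x) = q_j(x; G). *)
Definition mean phi G : R := \sum_(j < J) \int[M]_x (phi j x * q j x G).

Definition is_test phi : Prop :=
  (forall j, measurable_fun setT (phi j)) /\ (forall j x, 0 <= phi j x <= 1).

Lemma integrable_mul_q (f : Cov R J d -> R) (C : R) j G :
  measurable_fun setT f -> (forall x, `|f x| <= C) ->
  M.-integrable setT (EFin \o (fun x => f x * q j x G)).
Proof.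
move=> mf fC; apply: (@bounded_integrable _ _ _ _ _ C).
  by apply: measurable_funM => //; exact: measurable_q.
move=> x; rewrite normrM (ger0_norm (q_ge0 _ _ _)).
by rewrite (le_trans _ (fC x))// -[leRHS]mulr1 ler_wpM2l// q_le1.
Qed.

Lemma measurable_mean phi : is_test phi -> measurable_fun setT (mean phi).
Proof.
move=> [mphi phi01]; apply: measurable_sum => j.
apply: (@measurableT_comp _ _ _ _ _ _ fine) => //.
pose f (z : Cov R J d * giry (Beta R d) R) := (phi j z.1 * q j z.1 z.2)%:E.
apply: (@measurable_fun_fubini_tonelli_G _ _ _ _ _ M f).
  apply/measurable_EFinP; apply: measurable_funM; last exact: measurable_q2.
  by apply: (@measurableT_comp _ _ _ _ _ _ (phi j)).
move=> z; rewrite lee_fin mulr_ge0 ?q_ge0//.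
by have /andP[] := phi01 j z.1.
Qed.

(** Since phi^2 <= 1, the quadratic bound on exp is affine in phi; it integrates to 1 + 2 s^2 + s
    times the mean, and 1 + v <= exp(v). It serves with s = -t under a rejected G and with s = t
    under the truth. *)
Lemma mgf_le phi G (s : R) (j0 : 'I_J) :
  is_test phi -> is_prob G -> s <= 2^-1 ->
  (\sum_(j < J) \int[M]_x (expR (s * phi j x) * q j x G)%:E <=
   (expR (2 * s ^+ 2 + s * mean phi G))%:E)%E.
Proof.
move=> [mphi phi01] G1 s2.
have ip j : M.-integrable setT (EFin \o (fun x => phi j x * q j x G)).
  apply: (@integrable_mul_q _ 1) => // x.
  by have /andP[? ?] := phi01 j x; rewrite ger0_norm.
have iq j : M.-integrable setT (EFin \o (fun x => q j x G)).
  apply: (@bounded_integrable _ _ _ _ _ 1); first exact: measurable_q.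
  by move=> x; rewrite ger0_norm ?q_ge0// q_le1.
pose u j x := (1 + 2 * s ^+ 2) * q j x G + s * (phi j x * q j x G).
have uE j : (\int[M]_x (u j x)%:E = ((1 + 2 * s ^+ 2) * \int[M]_x (q j x G)
    + s * \int[M]_x (phi j x * q j x G))%:E)%E.
  rewrite /u.
  under eq_integral do rewrite EFinD !(EFinM (1 + _)) (EFinM s).
  have i1 := integrableZl measurableT (1 + 2 * s ^+ 2) (iq j).
  have i2 := integrableZl measurableT s (ip j).
  rewrite (integralD measurableT i1 i2) (integralZl measurableT (iq j)).
  rewrite (integralZl measurableT (ip j)).
  by rewrite -(fineK (integrable_fin_num _ (iq j)))// -(fineK (integrable_fin_num _ (ip j))).
apply: (@le_trans _ _ (\sum_(j < J) \int[M]_x (u j x)%:E)%E).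
  apply: lee_sum => j _; apply: ge0_le_integral => //.
  - by move=> x _; rewrite lee_fin mulr_ge0 ?expR_ge0 ?q_ge0.
  - apply/measurable_EFinP; apply: measurable_funM; last exact: measurable_q.
    by apply: measurableT_comp; [exact: measurable_expR|exact: measurable_funM].
  - apply/measurable_EFinP; apply: measurable_funD; apply: measurable_funM => //.
    + exact: measurable_q.
    + by apply: measurable_funM => //; exact: measurable_q.
  - move=> x _; rewrite lee_fin /u mulrA -mulrDl ler_wpM2r ?q_ge0//.
    have /andP[p0 p1] := phi01 j x.
    apply: le_trans (expR_le_quadratic _) _.
      have [s0|s0] := leP 0 s; last by nra.
      by rewrite (le_trans _ s2)// -[leRHS]mulr1 ler_wpM2l.
    have : 0 <= s ^+ 2 * (1 - phi j x ^+ 2).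
      by rewrite mulr_ge0 ?sqr_ge0// subr_ge0 expr_le1.
    rewrite exprMn; lra.
under eq_bigr do rewrite uE.
rewrite sumEFin lee_fin big_split/= -!mulr_sumr -/(mean phi G).
have -> : \sum_(j < J) \int[M]_x (q j x G) = 1.
  apply: EFin_inj; rewrite -sumEFin.
  under eq_bigr => j _ do
    rewrite /Rintegral (fineK (integrable_fin_num _ (iq j)))//.
  rewrite -ge0_integral_sum//; last 2 first.
    by move=> j; apply/measurable_EFinP; exact: measurable_q.
    by move=> j x _; rewrite lee_fin q_ge0.
  under eq_integral do rewrite sumEFin (sum_q _ j0 G1).
  by rewrite integral_cst//= mul1e probability_setT.
by rewrite mulr1 -addrA; exact: expR_ge1Dx.
Qed.

End mean.

(** * Almost sure decay of the integrated likelihood ratio over a rejected set *)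

Section numerator.
Context (R : realType) (J d : nat).
Context (dO : measure_display) (Omega : measurableType dO).
Variables (P : probability Omega R) (M : probability (Cov R J d) R).
Variables (G0 : giry (Beta R d) R) (Pi : giry (giry (Beta R d) R) R).
Variables (Y : nat -> Omega -> 'I_J) (X : nat -> Omega -> Cov R J d).
Hypothesis data : iid_mnl_data P M G0 Y X.
Hypothesis G01 : is_prob G0.
Variable j0 : 'I_J.
Implicit Types (phi : 'I_J -> Cov R J d -> R) (G : giry (Beta R d) R).

Definition rejected phi (eps : R) : set (giry (Beta R d) R) :=
  [set G | is_prob G /\ mean M phi G0 + eps <= mean M phi G].

Lemma measurable_rejected phi eps :
  is_test phi -> measurable (rejected phi eps).
Proof.
move=> tphi.
rewrite (_ : rejected _ _ = [set G | is_prob G] `&`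
    (mean M phi @^-1` `[mean M phi G0 + eps, +oo[%classic)).
  apply: measurableI; first exact: measurable_is_prob.
  by rewrite -[X in measurable X]setTI; apply: measurable_mean.
by apply/seteqP; split => G [? H]; split => //; move: H; rewrite /= in_itv/= andbT.
Qed.

Lemma lik_ratio_ge0 n w G : 0 <= lik_ratio G0 Y X n w G.
Proof. by apply: prodr_ge0 => i _; rewrite divr_ge0// q_ge0. Qed.

(** Joint measurability in (w, G) is needed to exchange the data law and the prior. The weight f is
    left free: the constant 1 yields the likelihood ratio, exp(- t phi) its weighted form. *)
Lemma measurable_factor2 (f : 'I_J -> Cov R J d -> R) i :
  (forall j, measurable_fun setT (f j)) ->
  measurable_fun [set: Omega * giry (Beta R d) R]
    (fun z : Omega * giry (Beta R d) R =>
       f (Y i z.1) (X i z.1) *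
       (q (Y i z.1) (X i z.1) z.2 / q (Y i z.1) (X i z.1) G0)).
Proof.
have [mX mY _] := data => mf.
apply: (@measurable_fun_select _ _ _ _ (fun z : Omega * giry (Beta R d) R => Y i z.1)
  (fun j z => f j (X i z.1) * (q j (X i z.1) z.2 / q j (X i z.1) G0))).
  move=> j; have := @measurable_fst _ _ Omega (giry (Beta R d) R) measurableT.
  by move=> /(_ [set w | Y i w = j] (mY i j)); rewrite setTI.
move=> j.
have mX1 : measurable_fun setT (fun z : Omega * giry (Beta R d) R => X i z.1).
  exact: measurableT_comp.
apply: measurable_funM; first exact: measurableT_comp.
apply: measurable_funM.
  apply: (@measurableT_comp _ _ _ _ _ _
    (fun z : Cov R J d * giry (Beta R d) R => q j z.1 z.2) _
    (fun z : Omega * giry (Beta R d) R => (X i z.1, z.2))).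
    exact: measurable_q2.
  exact: measurable_fun_pair.
apply: measurable_fun_invr_gt0; first by move=> z; exact: q_gt0.
apply: (@measurableT_comp _ _ _ _ _ _ (fun x : Cov R J d => q j x G0)) => //.
exact: measurable_q.
Qed.

Lemma measurable_lik_ratio n w : measurable_fun setT (lik_ratio G0 Y X n w).
Proof.
apply: measurable_prod => i _.
have := measurable_fun_pair2 w (measurable_factor2 i (fun j => measurable_cst (1 : R))).
apply: eq_measurable_fun => G _ /=.
by rewrite mul1r.
Qed.

(* Multiplying the likelihood by exp (- t phi) makes its expectation under the
   truth small on the rejected set; exp (t phi) compensates for the factor. *)
Lemma rejected_numerator_bound phi eps : is_test phi -> 0 < eps -> eps <= 1 ->
  {ae P, forall w, exists C : R, forall n,
    (\int[Pi]_(G in rejected phi eps) (lik_ratio G0 Y X n w G)%:E <=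
     (C * expR (- (eps ^+ 2 / 32)) ^+ n)%:E)%E}.
Proof.
move=> tphi eps0 eps1; have [mphi phi01] := tphi.
set A := rejected phi eps; have mA : measurable A by exact: measurable_rejected.
(* The product of the two rates [r] and [s] below is exp(4 t^2 - t eps), smallest at this t, where
   it equals exp(-eps^2/16). *)
pose t := eps / 8.
have t0 : 0 < t by rewrite divr_gt0.
have t2 : t <= 2^-1 by rewrite /t; lra.
have mexp (s : R) j : measurable_fun setT (fun x => expR (s * phi j x)).
  by apply: measurableT_comp; [exact: measurable_expR|exact: measurable_funM].
pose a0 := mean M phi G0.
pose f (z : Omega * giry (Beta R d) R) n := \1_A z.2 * \prod_(i < n)
   (expR (- t * phi (Y i z.1) (X i z.1)) *
     (q (Y i z.1) (X i z.1) z.2 / q (Y i z.1) (X i z.1) G0)).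
have f0 z n : 0 <= f z n.
  rewrite mulr_ge0// prodr_ge0// => i _.
  by rewrite mulr_ge0 ?expR_ge0// divr_ge0// q_ge0.
have mf n : measurable_fun setT (fun z => (f z n)%:E).
  apply/measurable_EFinP; apply: measurable_funM.
    apply: (@measurableT_comp _ _ _ _ _ _ (\1_A : giry (Beta R d) R -> R)) => //.
  apply: measurable_prod => i _.
  exact: (@measurable_factor2 (fun j x => expR (- t * phi j x))).
pose Z n w := (\int[Pi]_G (f (w, G) n)%:E)%E.
pose W n w := (\prod_(i < n) expR (t * phi (Y i w) (X i w)))%:E.
have mZ n : measurable_fun setT (Z n).
  by apply: (measurable_fun_fubini_tonelli_F _ (mf n)) => z; rewrite lee_fin.
have Z0 n w : (0 <= Z n w)%E by apply: integral_ge0 => G _; rewrite lee_fin.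
have mW n : measurable_fun setT (W n).
  apply/measurable_EFinP; apply: measurable_prod => i _.
  exact: (measurable_data data i (mexp t)).
have W0 n w : (0 <= W n w)%E by rewrite lee_fin prodr_ge0// => i _; exact: expR_ge0.
pose r := expR (2 * t ^+ 2 - t * (a0 + eps)).
pose s := expR (2 * t ^+ 2 + t * a0).
have Zr n : (\int[P]_w Z n w <= (r ^+ n)%:E)%E.
  rewrite /Z (fubini_tonelli _ (mf n)); last by move=> z; rewrite lee_fin.
  apply: (@le_trans _ _ (\int[Pi]_G (cst (r ^+ n)%:E G))%E); last first.
    rewrite integral_cst//= -[leRHS]mule1 lee_wpmul2l ?sprobability_setT//.
    by rewrite lee_fin exprn_ge0// expR_ge0.
  apply: ge0_le_integral => //.
  - by move=> G _; apply: integral_ge0 => w _; rewrite lee_fin.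
  - by apply: (measurable_fun_fubini_tonelli_G _ (mf n)) => z; rewrite lee_fin.
  move=> G _ /=.
  have [AG|nAG] := pselect (A G); last first.
    rewrite integral0_eq ?lee_fin ?exprn_ge0 ?expR_ge0// => w _.
    by rewrite /f/= indicE memNset// mul0r.
  rewrite /f; under eq_integral do rewrite /= indicE mem_set// mul1r.
  have [G1 AG2] := AG.
  apply: (@integral_prod_le _ _ _ _ _ _ _ _ _ _ data n
    (fun j x => expR (- t * phi j x) * (q j x G / q j x G0))).
  - move=> j; apply: measurable_funM => //; apply: measurable_funM.
      exact: measurable_q.
    apply: measurable_fun_invr_gt0; first by move=> z; exact: q_gt0.
    exact: measurable_q.
  - by move=> j x; rewrite mulr_ge0 ?expR_ge0// divr_ge0// q_ge0.
  (* Change of measure: q_j(x; G0) cancels the denominator, and the expectation becomes a moment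
     generating function under G, whose mean of phi is at least [a0 + eps]. *)
  - under eq_bigr => j _ do under eq_integral => x _ do
      rewrite -mulrA divfK ?gt_eqF ?q_gt0//.
    have tN : - t <= 2^-1 by lra.
    apply: le_trans (mgf_le M j0 tphi G1 tN) _.
    by rewrite lee_fin ler_expR sqrrN mulNr lerD2l lerN2 ler_pM2l.
have Ws n : (\int[P]_w W n w <= (s ^+ n)%:E)%E.
  apply: (@integral_prod_le _ _ _ _ _ _ _ _ _ _ data n (fun j x => expR (t * phi j x))).
  - by [].
  - by move=> j x; exact: expR_ge0.
  - exact: (mgf_le M j0).
(* Each of the two almost sure bounds loses a factor 1 / th per observation; together they halve the
   exponent eps^2/16. *)
pose th := expR (- (eps ^+ 2 / 64)).
have th0 : 0 < th by exact: expR_gt0.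
have th1 : th < 1 by rewrite -expR0 ltr_expR oppr_lt0 divr_gt0// exprn_gt0.
have := ae_geometric_bound (expR_gt0 _) th0 th1 mZ Z0 Zr.
have := ae_geometric_bound (expR_gt0 _) th0 th1 mW W0 Ws.
apply: filterS2 => w [C1 C10 HW] [C2 C20 HZ].
exists (C1 * C2) => n.
(* [W] does not involve G and leaves the integral, so both factors are bounded separately on the
   same path and no expectation of their product is needed. *)
have -> : (\int[Pi]_(G in A) (lik_ratio G0 Y X n w G)%:E = W n w * Z n w)%E.
  rewrite /Z -ge0_integralZl//; last 2 first.
  - by have := measurable_fun_pair2 w (mf n).
  - by move=> G _; rewrite lee_fin.
  rewrite [LHS]integral_mkcond.
  apply: eq_integral => G _.
  rewrite patchE -EFinM /f/=; case: ifPn => [AG|/negbTE AG]; rewrite indicE AG; last first.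
    by rewrite mul0r mulr0.
  rewrite mul1r -big_split/=; congr EFin; apply: eq_bigr => i _.
  by rewrite [RHS]mulrA -expRD mulNr subrr expR0 mul1r.
apply: (@le_trans _ _ ((C1 * (s / th) ^+ n)%:E * (C2 * (r / th) ^+ n)%:E)%E).
  by apply: lee_pmul.
rewrite -EFinM lee_fin mulrACA -exprMn.
rewrite (_ : s / th * (r / th) = expR (- (eps ^+ 2 / 32)))//.
rewrite /s /r /th -!expRN -!expRD; congr expR; rewrite /t; field; lra.
Qed.

End numerator.

(** * Subsequences along which all linear forms converge in the extended line *)

Lemma increasing_seq_cvgoo (s : nat -> nat) : increasing_seq s -> s @ \oo --> \oo.
Proof.
move=> si.
have le_s n : (n <= s n)%N.
  elim: n => // n IH; rewrite (leq_ltn_trans IH)//.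
  by have := si n.+1 n; rewrite ltnn => /negbT; rewrite -ltnNge.
by move=> A [N _ NA]; exists N => // n /= Nn; apply: NA => /=; rewrite (leq_trans Nn).
Qed.

Lemma increasing_seq_comp (s t : nat -> nat) :
  increasing_seq s -> increasing_seq t -> increasing_seq (s \o t).
Proof. by move=> si ti m n /=; rewrite si; exact: ti. Qed.

Lemma frequently_subseq (Q : nat -> Prop) :
  (forall n, exists2 m, (n <= m)%N & Q m) ->
  exists2 s, increasing_seq s & forall n, Q (s n).
Proof.
move=> hQ.
have /choice[f fP] : forall n, exists m, (n <= m)%N /\ Q m.
  by move=> n; have [m ? ?] := hQ n; exists m.
pose s := fix s n := if n is n'.+1 then f (s n').+1 else f 0%N.
exists s; last by case=> [|n] /=; [have [] := fP 0%N|have [] := fP (s n).+1].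
apply/increasing_seqP => n /=.
by have [] := fP (s n).+1.
Qed.

Section extraction.
Context (R : realType) (d : nat).
Implicit Types (b : nat -> 'I_d -> R) (z u : 'I_d -> R).

Definition ext_cvg (u : nat -> R) : Prop :=
  [\/ cvgn u, u @ \oo --> +oo | u @ \oo --> -oo].

(** Bolzano-Weierstrass one coordinate at a time: a further extraction keeps the limits already
    obtained. *)
Lemma bounded_subseq_cvg b (A : R) : (forall n k, `|b n k| <= A) ->
  exists2 s, increasing_seq s & forall k, cvgn (fun n => b (s n) k).
Proof.
move=> bA.
suff [s si H] : exists2 s, increasing_seq s &
    forall k, k \in enum 'I_d -> cvgn (fun n => b (s n) k).
  by exists s => // k; apply: H; rewrite mem_enum.
elim: (enum 'I_d) => [|k0 l [s si IH]]; first by exists id.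
have [|t ti bst] := @bolzano_weierstrass R (fun n => b (s n) k0).
  exists A; split; first exact: num_real.
  by move=> y Ay n _ /=; rewrite (le_trans (bA _ _))// ltW.
exists (s \o t); first exact: increasing_seq_comp.
move=> k; rewrite inE => /predU1P[->//|/IH/cvg_ex[a ba]].
apply/cvg_ex; exists a.
exact: (cvg_comp _ _ (increasing_seq_cvgoo ti) ba).
Qed.

Lemma cvg_dot b z u : (forall k, b n k @[n --> \oo] --> u k) ->
  \sum_(k < d) z k * b n k @[n --> \oo] --> \sum_(k < d) z k * u k.
Proof.
move=> bu; apply: cvg_big => [|k _]; first exact: add_continuous.
by apply: cvgM => //; exact: cvg_cst.
Qed.

(* If b is unbounded, its normalisation has a limit u; directions z not
   orthogonal to u diverge, and subtracting the right multiple of u from b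
   kills one coordinate without changing the other directions. *)
Lemma ext_cvg_extraction b :
  exists2 s, increasing_seq s &
    forall z, ext_cvg (fun n => \sum_(k < d) z k * b (s n) k).
Proof.
(* Induction on the size of a set S of coordinates outside which the sequence vanishes; each
   normalisation removes one element of S. *)
suff H m (S : {set 'I_d}) : (#|S| <= m)%N ->
    forall b, (forall n k, k \notin S -> b n k = 0) ->
    exists2 s, increasing_seq s &
      forall z, ext_cvg (fun n => \sum_(k < d) z k * b (s n) k).
  by apply: (H #|[set: 'I_d]%SET| [set: 'I_d]%SET) => // n k; rewrite inE.
elim: m S => [|m IH] S Sm {}b bS.
  exists id => // z; apply: Or31; apply/cvg_ex; exists 0.
  under eq_fun => n.
    rewrite big1; last first.
      move=> k _; rewrite bS ?mulr0//.
      by move: Sm; rewrite leqn0 cards_eq0 => /eqP ->; rewrite inE.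
    over.
  exact: cvg_cst.
pose N n := \sum_(k < d) `|b n k|.
have N0 n : 0 <= N n by exact: sumr_ge0.
have bN n k : `|b n k| <= N n by rewrite /N (bigD1 k)//= lerDl sumr_ge0.
(* If the l1 norms do not tend to infinity, they are infinitely often below a common bound, and a
   bounded subsequence has a convergent one. *)
have [Ny|nNy] := pselect (N @ \oo --> +oo); last first.
  have [A HA] : exists A : R, forall n, exists2 m, (n <= m)%N & N m <= A.
    apply: contrapT => /forallNP H; apply: nNy; apply/cvgryPge => A.
    have /existsNP[n nA] := H A; exists n => // k /= nk.
    rewrite leNgt; apply/negP => NkA; apply: nA; exists k => //.
    exact: ltW.
  have [s si sA] := frequently_subseq HA.
  have [t ti bst] := @bounded_subseq_cvg (b \o s) A (fun n k => le_trans (bN _ _) (sA n)).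
  exists (s \o t); first exact: increasing_seq_comp.
  move=> z; apply: Or31; apply/cvg_ex.
  have bstl k : exists a : R, b (s (t n)) k @[n --> \oo] --> a.
    by have /cvg_ex[a ba] := bst k; exists a.
  have [u bu] := choice bstl.
  by exists (\sum_(k < d) z k * u k); exact: (@cvg_dot (b \o (s \o t))).
pose r n k := b n k / N n.
have r1 n k : `|r n k| <= 1.
  rewrite normrM normfV (ger0_norm (N0 n)).
  have [->|Nn0] := eqVneq (N n) 0; first by rewrite invr0 mulr0.
  by rewrite ler_pdivrMr ?mul1r ?bN// lt_neqAle eq_sym Nn0 N0.
have [s si rs] := bounded_subseq_cvg r1.
have rsl k : exists a : R, r (s n) k @[n --> \oo] --> a.
  by have /cvg_ex[a ra] := rs k; exists a.
have [u ru] := choice rsl.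
have Nsy : N (s n) @[n --> \oo] --> +oo.
  exact: (cvg_comp _ _ (increasing_seq_cvgoo si) Ny).
(* The normalised vectors have l1 norm 1 as soon as N is nonzero, so they cannot all tend to 0. *)
have [k uk0] : exists k, u k != 0.
  apply: contrapT => /forallNP u0.
  have : \sum_(k < d) `|r (s n) k| @[n --> \oo] --> \sum_(k < d) `|u k|.
    apply: cvg_big => [|k _]; first exact: add_continuous.
    exact: cvg_norm.
  rewrite [X in _ --> X]big1; last first.
    by move=> k _; have /negP := u0 k; rewrite negbK => /eqP ->; rewrite normr0.
  move=> /cvgrPdist_lt/(_ 1 ltr01) near1.
  have near2 : \forall n \near \oo, 1 <= N (s n) by move/cvgryPge : Nsy; exact.
  have [n [n1 n2]] : exists n, `|0 - \sum_(k < d) `|r (s n) k| | < 1 /\ 1 <= N (s n).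
    by have [n] := @filter_ex _ _ _ _ (filterI near1 near2); exists n.
  have : \sum_(k < d) `|r (s n) k| = 1.
    rewrite /r; under eq_bigr do rewrite normrM normfV (ger0_norm (N0 _)).
    by rewrite -mulr_suml divff// gt_eqF// (lt_le_trans _ n2).
  by move=> E; move: n1; rewrite E sub0r normrN normr1 ltxx.
have uS l : l \notin S -> u l = 0.
  move=> lS; apply: (@cvg_unique _ (@Rhausdorff R) _ _ _ _ (ru l)).
  rewrite (_ : (fun n => r (s n) l) = fun=> 0); first exact: cvg_cst.
  by apply/funext => n; rewrite /r bS// mul0r.
have kS : k \in S by apply: contraT => /uS/eqP; rewrite (negbTE uk0).
(* This multiple of u cancels coordinate k. The difference still vanishes outside S, because u, as a
   limit, is zero wherever b is. *)
pose c n := b (s n) k / u k.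
pose b' n l := b (s n) l - c n * u l.
have [||t ti b't] := IH (S :\ k) _ b'.
- by rewrite (cardsD1 k) kS in Sm.
- move=> n l; rewrite !inE negb_and negbK => /orP[/eqP ->|lS].
    by rewrite /b' /c divfK// subrr.
  by rewrite /b' bS// uS// mulr0 subrr.
exists (s \o t); first exact: increasing_seq_comp.
move=> z; have [zu0|zu0] := eqVneq (\sum_(l < d) z l * u l) 0.
  have := b't z; congr ext_cvg; apply/funext => n.
  rewrite /b'; under eq_bigr do rewrite mulrBr mulrCA.
  by rewrite sumrB -mulr_sumr zu0 mulr0 subr0.
have zr : \sum_(l < d) z l * r (s (t n)) l @[n --> \oo] --> \sum_(l < d) z l * u l.
  have zr0 : \sum_(l < d) z l * r (s n) l @[n --> \oo] --> \sum_(l < d) z l * u l.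
    exact: (@cvg_dot (r \o s)).
  exact: (cvg_comp _ _ (increasing_seq_cvgoo ti) zr0).
have Nst : N (s (t n)) @[n --> \oo] --> +oo.
  exact: (cvg_comp _ _ (increasing_seq_cvgoo ti) Nsy).
have E n : \sum_(l < d) z l * b (s (t n)) l =
    N (s (t n)) * \sum_(l < d) z l * r (s (t n)) l.
  rewrite mulr_sumr; apply: eq_bigr => l _; rewrite /r.
  (* Where N is 0 the quotient defaults to 0; the identity survives because all coordinates of b
     vanish there. *)
  have [N00|Nn0] := eqVneq (N (s (t n))) 0; last by field.
  have := bN (s (t n)) l; rewrite N00 normr_le0 => /eqP ->.
  by rewrite mul0r !mulr0.
have half (v : nat -> R) (a : R) : 0 < a -> v n @[n --> \oo] --> a ->
    N (s (t n)) * v n @[n --> \oo] --> +oo.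
  move=> a0 va; apply/cvgryPge => A.
  have a20 : 0 < a / 2 by rewrite divr_gt0.
  near=> n.
  have h1 : `|A| / (a / 2) <= N (s (t n)) by near: n; move/cvgryPge : Nst; exact.
  have h2 : a / 2 < v n.
    have : `|a - v n| < a / 2 by near: n; move/cvgrPdist_lt : va; exact.
    by rewrite ltr_norml => /andP[_]; lra.
  rewrite (le_trans (ler_norm A))//.
  rewrite ler_pdivrMr// in h1; rewrite (le_trans h1)//.
  by rewrite ler_wpM2l// ltW.
have [zpos|zneg] := ltP 0 (\sum_(l < d) z l * u l).
  apply: Or32; under eq_fun do rewrite E.
  exact: half zr.
apply: Or33; under eq_fun do rewrite E.
apply/cvgNry.
rewrite [X in X @ _ --> _](_ : _ = fun n =>
    N (s (t n)) * - \sum_(l < d) z l * r (s (t n)) l); last first.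
  by apply/funext => n; rewrite mulrN.
apply: half (cvgN zr).
by rewrite oppr_gt0 lt_neqAle zu0 zneg.
Unshelve. all: by end_near. Qed.

End extraction.

(** * Total boundedness of the kernels in L1(M) and its effect on tests *)

Section compactness.
Context (R : realType) (J d : nat).
Implicit Types (j : 'I_J) (x : 'M[R]_(J, d)) (b : 'rV[R]_d).

(** The inverse kernel is a sum of exponentials of linear forms in b, so one subsequence serves all
    x at once. If some exponent tends to +oo, the kernel tends to 0; otherwise the sum has a finite
    limit, at least 1 because of the term l = j, and inversion is continuous there. *)
Lemma mnl_kernel_subseq_cvg (b : nat -> 'rV[R]_d) : exists2 s, increasing_seq s &
  forall j x, cvgn (fun n => mnl_kernel j x (b (s n))).
Proof.
have [s si bs] := ext_cvg_extraction (fun n k => b n ord0 k).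
exists s => // j x.
pose a l n := \sum_(k < d) (x l k - x j k) * b (s n) ord0 k.
have kE n : mnl_kernel j x (b (s n)) = (\sum_(l < J) expR (a l n))^-1.
  rewrite mnl_kernelE; congr (_^-1); apply: eq_bigr => l _; congr expR.
  by rewrite /dotp -sumrB; apply: eq_bigr => k _; rewrite mulrBl.
have aj n : a j n = 0 by rewrite /a big1// => k _; rewrite subrr mul0r.
under eq_fun do rewrite kE.
have S0 n : 0 < \sum_(l < J) expR (a l n) by exact: (sum_expR_gt0 j).
have [[l aly]|noy] := pselect (exists l, a l @ \oo --> +oo).
  apply/cvg_ex; exists 0.
  apply: (@squeeze_cvgr _ _ _ _ (fun=> 0) (fun n => expR (- a l n))).
  - apply: nearW => n; rewrite invr_ge0 (ltW (S0 n))/= expRN.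
    rewrite lef_pV2 ?posrE ?expR_gt0// (bigD1 l)//= lerDl.
    by apply: sumr_ge0 => i _; exact: expR_ge0.
  - exact: cvg_cst.
  - exact: (cvg_comp _ _ aly (@cvgr_expR R)).
have expc l : exists c : R, expR (a l n) @[n --> \oo] --> c.
  case: (bs (fun k => x l k - x j k)) => [/cvg_ex[c ac]|ay|aNy].
  - by exists (expR c); exact: (cvg_comp _ _ ac (@continuous_expR R c)).
  - by exfalso; apply: noy; exists l.
  - exists 0; rewrite -[X in X @ _ --> _](_ : (fun n => expR (- - a l n)) = _).
      have aN : - a l n @[n --> \oo] --> +oo by apply/cvgNry.
      exact: (cvg_comp _ _ aN (@cvgr_expR R)).
    by apply/funext => n; rewrite opprK.
have [c ec] := choice expc.
have sc : \sum_(l < J) expR (a l n) @[n --> \oo] --> \sum_(l < J) c l.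
  by apply: cvg_big => [|l _]; first exact: add_continuous.
apply/cvg_ex; exists (\sum_(l < J) c l)^-1; apply: cvgV => //.
have c0 l : 0 <= c l.
  rewrite -(cvg_lim (@Rhausdorff R) (ec l)); apply: limr_ge.
    by apply/cvg_ex; exists (c l).
  by apply: nearW => n; exact: expR_ge0.
have cj : c j = 1.
  apply: (@cvg_unique _ (@Rhausdorff R) _ _ _ _ (ec j)).
  rewrite (_ : (fun n => expR (a j n)) = fun=> 1); first exact: cvg_cst.
  by apply/funext => n; rewrite aj expR0.
by rewrite gt_eqF// (bigD1 j)//= cj ltr_pwDl// sumr_ge0.
Qed.

Variable M : probability (Cov R J d) R.

Definition kernel_dist (b b' : 'rV[R]_d) : R :=
  \sum_(j < J) \int[M]_x `|mnl_kernel j x b - mnl_kernel j x b'|.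

Lemma kernel_diff_le1 j x (b b' : 'rV[R]_d) :
  `|mnl_kernel j x b - mnl_kernel j x b'| <= 1.
Proof.
have := mnl_kernel_gt0 j x b; have := mnl_kernel_gt0 j x b'.
have := mnl_kernel_le1 j x b; have := mnl_kernel_le1 j x b'.
by rewrite ler_norml => *; apply/andP; split; lra.
Qed.

Lemma measurable_kernel_diff j (b b' : 'rV[R]_d) :
  measurable_fun [set: Cov R J d]
    ((fun x => `|mnl_kernel j x b - mnl_kernel j x b'|) : Cov R J d -> R).
Proof.
apply: measurableT_comp => //.
by apply: measurable_funB; exact: measurable_mnl_kernel_cov.
Qed.

(* Separated sequences are impossible: along a subsequence the kernels converge
   pointwise, hence in L1(M) by dominated convergence. *)
Lemma kernel_totally_bounded (eta : R) : 0 < eta ->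
  exists s : seq 'rV[R]_d, forall b, exists2 b', b' \in s & kernel_dist b b' <= eta.
Proof.
move=> eta0; apply: contrapT => /forallNP H.
have nexts (s : seq 'rV[R]_d) : exists b, forall b', b' \in s -> eta < kernel_dist b b'.
  have /existsNP[b Hb] := H s; exists b => b' b's.
  by rewrite ltNge; apply/negP => ?; apply: Hb; exists b'.
have [next nextP] := choice nexts.
(* [L n] lists the first n points of the sequence; each new point is chosen far from all the
   previous ones. *)
pose L := fix L n := if n is n'.+1 then next (L n') :: L n' else [::].
pose b n := next (L n).
have bL m n : (m < n)%N -> b m \in L n.
  elim: n => // n IH; rewrite ltnS leq_eqVlt => /predU1P[->|/IH ?].
    by rewrite inE eqxx.
  by rewrite inE; apply/orP; right.
have sep m n : (m < n)%N -> eta < kernel_dist (b n) (b m).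
  by move=> mn; apply: nextP; exact: bL.
have [s si ks] := mnl_kernel_subseq_cvg b.
(* Comparing consecutive terms avoids the pointwise limit itself, which need not be the kernel of
   any [beta]. *)
have : kernel_dist (b (s n.+1)) (b (s n)) @[n --> \oo] --> (0 : R).
  rewrite -[X in _ --> X](_ : \sum_(j < J) 0 = 0); last by rewrite big1.
  apply: cvg_big => [|j _]; first exact: add_continuous.
  apply: fine_cvg.
  rewrite (_ : 0%:E = \int[M]_x (cst 0%E x))%E; last by rewrite integral0.
  apply: (@dominated_cvg _ _ _ M setT measurableT
    (fun n x => (`|mnl_kernel j x (b (s n.+1)) - mnl_kernel j x (b (s n))|)%:E)
    (cst 0%E) (cst 1%E)).
  - by move=> n; apply/measurable_EFinP; exact: measurable_kernel_diff.
  - move=> x _; apply: cvg_EFin; first exact: nearW.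
    have /cvg_ex[c kc] := ks j x.
    rewrite -[X in _ --> X](_ : `|c - c| = 0); last by rewrite subrr normr0.
    apply: cvg_norm; apply: cvgB => //.
    by move: kc; rewrite -(cvg_shiftS (fun n => mnl_kernel j x (b (s n)))).
  - by [].
  - exact: finite_measure_integrable_cst.
  - by move=> n x _; rewrite gee0_abs ?lee_fin// kernel_diff_le1.
move=> /cvgrPdist_lt/(_ _ eta0) => -[N _ /(_ N (leqnn N))] /=.
rewrite sub0r normrN ltNge => /negP; apply.
rewrite (le_trans _ (ler_norm _))// ltW// sep//.
by move/increasing_seqP : si; exact.
Qed.

(** The value of [mean] at the point mass at b; [mean] is its average under G. *)
Definition kernel_mean (phi : 'I_J -> Cov R J d -> R) (b : 'rV[R]_d) : R :=
  \sum_(j < J) \int[M]_x (phi j x * mnl_kernel j x b).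

Section test.
Variable phi : 'I_J -> Cov R J d -> R.
Hypothesis tphi : is_test phi.

Lemma test_norm_le1 j x : `|phi j x| <= 1.
Proof. by have [_ /(_ j x) /andP[? ?]] := tphi; rewrite ger0_norm. Qed.

Lemma integrable_test_kernel j (b : 'rV[R]_d) :
  M.-integrable setT (EFin \o (fun x => phi j x * mnl_kernel j x b)).
Proof.
apply: (@bounded_integrable _ _ _ _ _ 1).
  have [mphi _] := tphi; apply: measurable_funM => //.
  exact: measurable_mnl_kernel_cov.
move=> x; rewrite normrM mulr_ile1// ?test_norm_le1//.
by rewrite ger0_norm ?mnl_kernel_le1// ltW// mnl_kernel_gt0.
Qed.

Lemma integrable_test_q j G :
  M.-integrable setT (EFin \o (fun x => phi j x * q j x G)).
Proof.
have [mphi _] := tphi; apply: (@integrable_mul_q _ _ _ _ _ 1) => // x.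
exact: test_norm_le1.
Qed.

Lemma kernel_mean_ge0 b : 0 <= kernel_mean phi b.
Proof.
apply: sumr_ge0 => j _; apply: Rintegral_ge0 => x _.
have [_ /(_ j x) /andP[? _]] := tphi.
by rewrite mulr_ge0// ltW// mnl_kernel_gt0.
Qed.

Lemma kernel_mean_le1 (j0 : 'I_J) b : kernel_mean phi b <= 1.
Proof.
have ik j : M.-integrable setT (EFin \o (fun x => mnl_kernel j x b)).
  apply: (@bounded_integrable _ _ _ _ _ 1); first exact: measurable_mnl_kernel_cov.
  by move=> x; rewrite ger0_norm ?mnl_kernel_le1// ltW// mnl_kernel_gt0.
apply: (@le_trans _ _ (\sum_(j < J) \int[M]_x mnl_kernel j x b)).
  apply: ler_sum => j _; apply: le_Rintegral => //.
    exact: integrable_test_kernel.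
  move=> x _; rewrite -[leRHS]mul1r ler_wpM2r//; first by rewrite ltW// mnl_kernel_gt0.
  by have [_ /(_ j x) /andP[]] := tphi.
rewrite -lee_fin -sumEFin.
under eq_bigr => j _ do
  rewrite /Rintegral (fineK (integrable_fin_num _ (ik j)))//.
rewrite -ge0_integral_sum//; last 2 first.
  by move=> j; apply/measurable_EFinP; exact: measurable_mnl_kernel_cov.
  by move=> j x _; rewrite lee_fin ltW// mnl_kernel_gt0.
under eq_integral do rewrite sumEFin (sum_mnl_kernel _ _ j0).
by rewrite integral_cst//= mul1e probability_setT.
Qed.

(** As |phi| <= 1, the Lipschitz constant is the same for all tests: with a finite net for
    [kernel_dist], this equicontinuity gives an Arzela-Ascoli argument. *)
Lemma kernel_mean_lipschitz b b' :
  `|kernel_mean phi b - kernel_mean phi b'| <= kernel_dist b b'.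
Proof.
rewrite -sumrB (le_trans (ler_norm_sum _ _ _))// ler_sum// => j _.
rewrite -RintegralB//; [|exact: integrable_test_kernel..].
have iB : M.-integrable setT (EFin \o
    (fun x => phi j x * mnl_kernel j x b - phi j x * mnl_kernel j x b')).
  exact: (integrableB measurableT (integrable_test_kernel j b) (integrable_test_kernel j b')).
apply: (le_trans (le_normr_Rintegral measurableT iB)).
apply: le_Rintegral => //.
- exact: integrable_norm.
- apply: (@bounded_integrable _ _ _ _ _ 1); first exact: measurable_kernel_diff.
  by move=> x; rewrite normr_id kernel_diff_le1.
- move=> x _; rewrite -mulrBr normrM -[leRHS]mul1r ler_wpM2r//.
  exact: test_norm_le1.
Qed.

Lemma mean_kernel_mean (G : giry (Beta R d) R) :
  (mean M phi G)%:E = (\int[G]_b (kernel_mean phi b)%:E)%E.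
Proof.
have [mphi phi01] := tphi.
have phi0 j x : 0 <= phi j x by have /andP[] := phi01 j x.
pose f j (z : Cov R J d * Beta R d) := (phi j z.1 * mnl_kernel j z.1 z.2)%:E.
have f0 j z : (0 <= f j z)%E.
  by rewrite lee_fin mulr_ge0// ltW// mnl_kernel_gt0.
have mf j : measurable_fun setT (f j).
  apply/measurable_EFinP; apply: measurable_funM; last exact: measurable_mnl_kernel2.
  exact: (@measurableT_comp _ _ _ _ _ _ (phi j)).
rewrite -sumEFin.
transitivity (\sum_(j < J) \int[G]_b \int[M]_x f j (x, b))%E.
  apply: eq_bigr => j _.
  rewrite /Rintegral (fineK (integrable_fin_num _ (integrable_test_q j G)))//.
  transitivity (\int[M]_x \int[G]_b f j (x, b))%E; last exact: fubini_tonelli.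
  apply: eq_integral => x _; rewrite /f /= EFinM qE -ge0_integralZl//.
  - by apply/measurable_EFinP; exact: measurable_mnl_kernel.
  - by move=> b _; rewrite lee_fin ltW// mnl_kernel_gt0.
  - by rewrite lee_fin.
rewrite -ge0_integral_sum//; last 2 first.
- by move=> j; apply: (measurable_fun_fubini_tonelli_G _ (mf j)).
- by move=> j b _; exact: integral_ge0.
apply: eq_integral => b _; rewrite -sumEFin; apply: eq_bigr => j _.
by rewrite /Rintegral (fineK (integrable_fin_num _ (integrable_test_kernel j b))).
Qed.

End test.

(** A comparison of two tests uniform in b is inherited by every mixture; total mass 1 keeps the
    error at k. *)
Lemma mean_le_kernel_mean phi phi' (k : R) (G : giry (Beta R d) R) :
  is_test phi -> is_test phi' -> is_prob G -> 0 <= k ->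
  (forall b, kernel_mean phi b <= kernel_mean phi' b + k) ->
  mean M phi G <= mean M phi' G + k.
Proof.
move=> tphi tphi' G1 k0 H; rewrite -lee_fin EFinD !mean_kernel_mean//.
have -> : k%:E = (\int[G]_b (cst k%:E b))%E by rewrite integral_cst//= [X in (_ * X)%E]G1 mule1.
have mm psi : is_test psi -> measurable_fun [set: Beta R d]
    (fun b => (kernel_mean psi b)%:E).
  move=> [mpsi psi01]; apply/measurable_EFinP; apply: measurable_sum => j.
  apply: (@measurableT_comp _ _ _ _ _ _ fine) => //.
  pose f (z : Cov R J d * Beta R d) := (psi j z.1 * mnl_kernel j z.1 z.2)%:E.
  apply: (@measurable_fun_fubini_tonelli_G _ _ _ _ _ M f).
    apply/measurable_EFinP; apply: measurable_funM; last exact: measurable_mnl_kernel2.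
    exact: (@measurableT_comp _ _ _ _ _ _ (psi j)).
  move=> z; rewrite lee_fin mulr_ge0//; first by have /andP[] := psi01 j z.1.
  by rewrite ltW// mnl_kernel_gt0.
rewrite -ge0_integralD//; last 2 first.
- by move=> b _; rewrite lee_fin kernel_mean_ge0.
- exact: mm.
apply: ge0_le_integral => //.
- by move=> b _; rewrite lee_fin kernel_mean_ge0.
- exact: mm.
- by apply: emeasurable_funD => //; exact: mm.
- by move=> b _; rewrite lee_fin.
Qed.

End compactness.

Lemma sqrt_sum_sqr_le (R : realType) (n : nat) (a : 'I_n -> R) :
  Num.sqrt (\sum_(i < n) a i ^+ 2) <= \sum_(i < n) `|a i|.
Proof.
have S0 : 0 <= \sum_(i < n) `|a i| by exact: sumr_ge0.
rewrite -(ger0_norm S0) -sqrtr_sqr ler_wsqrtr// expr2 mulr_suml ler_sum// => i _.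
rewrite -(real_normK (num_real (a i))) expr2 ler_wpM2l// (bigD1 i)//= lerDl.
exact: sumr_ge0.
Qed.

Lemma ler_dist3 (R : realType) (a b c d r s t : R) :
  `|a - b| <= r -> `|b - c| <= s -> `|d - c| <= t -> `|a - d| <= r + s + t.
Proof.
rewrite !ler_norml => /andP[? ?] /andP[? ?] /andP[? ?].
by apply/andP; split; lra.
Qed.

(** * Finitely many tests separating the distant G from G0 *)

Section cover.
Context (R : realType) (J d : nat).
Variables (M : probability (Cov R J d) R) (G0 : giry (Beta R d) R).
Hypothesis G01 : is_prob G0.
Variable j0 : 'I_J.

(** The indicator of the Scheffe set: among tests it has the largest gap between its means under G
    and under G0. *)
Definition sign_test (G : giry (Beta R d) R) (j : 'I_J) (x : Cov R J d) : R :=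
  (q j x G0 < q j x G)%R%:R.

Lemma sign_test_is_test G : is_test (sign_test G).
Proof.
split=> [j|j x]; last by rewrite /sign_test; case: ltP; rewrite ?lexx ler01.
rewrite (_ : sign_test G j = \1_[set x : Cov R J d | q j x G0 < q j x G]).
  apply: measurable_indic.
  rewrite -[X in measurable X]setTI.
  have := measurable_fun_ltr (measurable_q j G0) (measurable_q j G) measurableT.
  by move=> /(_ [set true] I); congr measurable.
apply/funext => x; rewrite /sign_test indicE; congr (_%:R).
by congr nat_of_bool; apply/idP/idP => [?|/set_mem//]; apply/mem_set.
Qed.

(** Both vectors of probabilities sum to 1, so the positive and negative parts of their difference
    have equal sums and the l1 norm is twice the positive part, which the sign test selects. The l1
    norm dominates the Euclidean one. *)
Lemma qdist_le_sign_test X G : is_prob G ->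
  qdist M X G G0 <= 2 * (mean M (sign_test G) G - mean M (sign_test G) G0).
Proof.
move=> G1; have tG := sign_test_is_test G.
pose a j (x : Cov R J d) := q j x G - q j x G0.
have ma j : measurable_fun setT (a j) by apply: measurable_funB; exact: measurable_q.
have FE (x : Cov R J d) : \sum_(j < J) `|a j x| = \sum_(j < J)
    2 * (sign_test G j x * q j x G - sign_test G j x * q j x G0).
  apply/eqP; rewrite -subr_eq0 -sumrB.
  rewrite (eq_bigr (fun j => - a j x)); last first.
    move=> j _; rewrite /sign_test /a; case: ltP => h; rewrite ?mul1r ?mul0r.
      by rewrite gtr0_norm ?subr_gt0//; lra.
    by rewrite ler0_norm ?subr_le0//; lra.
  by rewrite sumrN /a sumrB !(sum_q _ j0)// subrr oppr0.
have ipsi G' j := integrable_test_q M tG j G'.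
have iD j : M.-integrable setT (fun x => (2 * (sign_test G j x * q j x G -
    sign_test G j x * q j x G0))%:E).
  exact: (integrableZl measurableT 2 (integrableB measurableT (ipsi G j) (ipsi G0 j))).
have E : (\int[M]_x (\sum_(j < J) `|a j x|)%:E =
    (2 * (mean M (sign_test G) G - mean M (sign_test G) G0))%:E)%E.
  under eq_integral do rewrite FE -sumEFin.
  rewrite integral_sum// -sumrB mulr_sumr -sumEFin; apply: eq_bigr => j _.
  under eq_integral do rewrite EFinM.
  rewrite integralZl//; last first.
    exact: (integrableB measurableT (ipsi G j) (ipsi G0 j)).
  rewrite EFinM; congr (_ * _)%E.
  rewrite -RintegralB// /Rintegral fineK//.
  apply: integrable_fin_num => //.
  exact: (integrableB measurableT (ipsi G j) (ipsi G0 j)).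
have le1 : (\int[M]_(x in X) (Num.sqrt (\sum_(j < J) (q j x G - q j x G0) ^+ 2))%:E
    <= \int[M]_x (\sum_(j < J) `|a j x|)%:E)%E.
  apply: ge0_le_integral_weak => [x _|x _|x Xx].
  - by rewrite lee_fin sqrtr_ge0.
  - by rewrite lee_fin sumr_ge0.
  - split=> //; rewrite lee_fin; exact: sqrt_sum_sqr_le.
rewrite -lee_fin -E /qdist fineK//.
rewrite ge0_fin_numE; last by apply: integral_ge0 => x _; rewrite lee_fin sqrtr_ge0.
by rewrite (le_lt_trans le1)// E ltry.
Qed.

(* The functions [kernel_mean M phi] are determined, up to a small uniform error,
   by their values on a finite net; hence finitely many tests suffice. *)
Lemma finite_tests (e : R) X : 0 < e ->
  exists (T : finType) (Phi : T -> 'I_J -> Cov R J d -> R),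
    (forall i, is_test (Phi i)) /\
    forall G, is_prob G -> e < qdist M X G G0 ->
      exists i, rejected M G0 (Phi i) (e / 4) G.
Proof.
move=> e0.
(* Two net errors e/32 and a rounding error at most e/16 make tests of one cell e/8-close. The sign
   test has a gap above e/2; replacing it under both G and G0 costs twice e/8 and leaves e/4. *)
have [s sP] := @kernel_totally_bounded R J d M (e / 32) ltac:(lra).
pose N := (truncn (16 / e)).+1.
have N0 : 0 < N%:R :> R by rewrite ltr0n.
have Ne : N%:R^-1 <= e / 16.
  rewrite -[e / 16]invrK lef_pV2 ?posrE ?invr_gt0 ?divr_gt0// invf_div.
  by have /andP[_ /ltW] := @truncn_itv R (16 / e) ltac:(by rewrite divr_ge0// ltW).
have sumle : e / 32 + N%:R^-1 + e / 32 <= e / 8 by lra.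
pose val phi (i : 'I_(size s)) := kernel_mean M phi (nth 0 s i) * N%:R.
(* A kernel mean lies in [0, 1], so its rounding runs from 0 to N inclusive and [inord] never falls
   back to its default. *)
pose cell phi : {ffun 'I_(size s) -> 'I_N.+1} := [ffun i => inord (truncn (val phi i))].
have val0 phi i : is_test phi -> 0 <= val phi i.
  by move=> t; rewrite mulr_ge0// ?kernel_mean_ge0// ltW.
have cellP phi phi' : is_test phi -> is_test phi' -> cell phi = cell phi' ->
    forall i : 'I_(size s),
      `|kernel_mean M phi (nth 0 s i) - kernel_mean M phi' (nth 0 s i)| <= N%:R^-1.
  move=> t t' cc i.
  have tl psi : is_test psi -> (truncn (val psi i) < N.+1)%N.
    move=> tpsi; rewrite ltnS -(ler_nat R).
    have /andP[h _] := truncn_itv (val0 psi i tpsi).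
    by rewrite (le_trans h)// -[leRHS]mul1r ler_wpM2r ?kernel_mean_le1// ltW.
  have : truncn (val phi i) = truncn (val phi' i).
    by move/ffunP/(_ i): cc; rewrite !ffunE => /(congr1 (@nat_of_ord _)); rewrite !inordK ?tl.
  move=> tt; have := truncn_itv (val0 phi i t); have := truncn_itv (val0 phi' i t').
  rewrite tt -natr1 => /andP[h1 h2] /andP[h3 h4].
  rewrite -[leRHS]mul1r ler_pdivlMr//.
  rewrite [leLHS](_ : _ = `|val phi i - val phi' i|).
    by rewrite ler_norml; apply/andP; split; lra.
  by rewrite /val -mulrBl normrM (gtr0_norm N0).
have zt : is_test (fun (_ : 'I_J) (_ : Cov R J d) => 0 : R).
  by split=> [j|j x]; [exact: measurable_cst|rewrite lexx ler01].
(* One representative per cell; an empty cell receives the zero test. *)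
have rep (v : {ffun 'I_(size s) -> 'I_N.+1}) :
    exists phi, is_test phi /\ forall phi', is_test phi' -> cell phi' = v -> cell phi = v.
  have [[phi [t c]]|no] := pselect (exists phi, is_test phi /\ cell phi = v).
    by exists phi.
  by exists (fun=> fun=> 0); split=> // phi' t c; exfalso; apply: no; exists phi'.
have [Phi PhiP] := choice rep.
exists {ffun 'I_(size s) -> 'I_N.+1}, Phi; split; first by move=> v; have [] := PhiP v.
move=> G G1 eG; exists (cell (sign_test G)).
set phi := sign_test G; set phi' := Phi (cell phi).
have t : is_test phi by exact: sign_test_is_test.
have t' : is_test phi' by have [] := PhiP (cell phi).
have cc : cell phi = cell phi' by have [_ /(_ _ t erefl)] := PhiP (cell phi).
have close b : `|kernel_mean M phi b - kernel_mean M phi' b| <= e / 8.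
  have [b' /(nthP 0)[i si <-] bb'] := sP b.
  have h1 := cellP _ _ t t' cc (Ordinal si).
  have h2 := le_trans (kernel_mean_lipschitz M t b (nth 0 s i)) bb'.
  have h3 := le_trans (kernel_mean_lipschitz M t' b (nth 0 s i)) bb'.
  exact: (le_trans (ler_dist3 h2 h1 h3) sumle).
split=> //.
have l1 : mean M phi G <= mean M phi' G + e / 8.
  apply: mean_le_kernel_mean => //; first lra.
  by move=> b; have := close b; rewrite ler_norml => /andP[_]; lra.
have l2 : mean M phi' G0 <= mean M phi G0 + e / 8.
  apply: mean_le_kernel_mean => //; first lra.
  by move=> b; have := close b; rewrite ler_norml => /andP[+ _]; lra.
have := qdist_le_sign_test X G1; rewrite -/phi; lra.
Qed.

End cover.

(** The chain runs from q(x; G0) to q(x; G): cut off (cost c s), move to a grid point (factor u),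
    replace G0 by G (cost c s), move back (factor u), drop the cutoff. As c <= q0, both costs are at
    most s q0, and u - 2 s = u^3 leaves the total factor u^4. *)
Lemma weak_neighbourhood_arith (R : realType) (u s c q0 b0 y0 y1 b1 q1 : R) :
  0 < u -> u < 1 -> 0 < s -> 0 < c -> 2 * s = u - u ^+ 3 -> c <= q0 ->
  q0 <= b0 + c * s -> u * b0 <= y0 -> - (c * s) < y1 - y0 -> u * y1 <= b1 ->
  b1 <= q1 -> u ^+ 4 * q0 <= q1.
Proof.
move=> u0 u1 s0 c0 us cq h1 h2 h3 h4 h5.
have csq : c * s <= s * q0 by rewrite mulrC ler_pM2l.
apply: (le_trans _ (le_trans h4 h5)).
rewrite (_ : u ^+ 4 = u * u ^+ 3); last by ring.
rewrite -mulrA ler_pM2l//.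
have e1 : u * (q0 - s * q0) <= y0.
  by apply: le_trans h2; rewrite ler_pM2l//; lra.
have e2 : u * (s * q0) <= s * q0.
  have q00 : 0 < q0 by exact: lt_le_trans c0 cq.
  by rewrite ger_pMl ?mulr_gt0// ltW.
rewrite (_ : u ^+ 3 = u - 2 * s); last by rewrite us; ring.
lra.
Qed.

(** * A weak neighbourhood of G0 with a uniform lower bound on choice probabilities *)

Section neighbourhood.
Context (R : realType) (J d : nat).
Implicit Types (j : 'I_J) (x y : 'M[R]_(J, d)) (b : 'rV[R]_d).
Implicit Types G : giry (Beta R d) R.

Definition norm1 b : R := \sum_(k < d) `|b ord0 k|.

(** A continuous tent vanishing once the l1 norm reaches n + 1. It keeps test functions admissible
    for the weak topology while confining [beta] to a bounded set. *)
Definition bump (n : nat) b : R := Num.max 0 (1 - norm1 b / n.+1%:R).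

Definition bumped_kernel n j x b : R := bump n b * mnl_kernel j x b.

Lemma norm1_ge0 b : 0 <= norm1 b.
Proof. exact: sumr_ge0. Qed.

Lemma bump_ge0 n b : 0 <= bump n b.
Proof. by rewrite le_max lexx. Qed.

Lemma bump_le1 n b : bump n b <= 1.
Proof. by rewrite ge_max ler01 gerBl divr_ge0// norm1_ge0. Qed.

Lemma bumped_kernel_ge0 n j x b : 0 <= bumped_kernel n j x b.
Proof. by rewrite mulr_ge0 ?bump_ge0// ltW// mnl_kernel_gt0. Qed.

Lemma bumped_kernel_le n j x b : bumped_kernel n j x b <= mnl_kernel j x b.
Proof.
by rewrite -[leRHS]mul1r ler_wpM2r ?bump_le1// ltW// mnl_kernel_gt0.
Qed.

Lemma bumped_kernel_le1 n j x b : bumped_kernel n j x b <= 1.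
Proof. exact: le_trans (bumped_kernel_le _ _ _ _) (mnl_kernel_le1 _ _ _). Qed.

Lemma continuous_row_coord (k : 'I_d) : continuous (fun b => b ord0 k).
Proof. exact: coord_continuous. Qed.

Lemma continuous_norm1 : continuous norm1.
Proof.
apply: continuous_big => [|k _ b]; first exact: add_continuous.
exact: (cvg_norm (@continuous_row_coord k b)).
Qed.

Lemma continuous_bump n : continuous (bump n).
Proof.
move=> b.
have c1 : {for b, continuous ((fun=> 0) : 'rV[R]_d -> R^o)}.
  exact: (@cst_continuous _ _ _ b).
have c2 : {for b, continuous ((fun b => 1 - norm1 b / n.+1%:R) : 'rV[R]_d -> R^o)}.
  apply: continuousB; first exact: (@cst_continuous _ _ _ b).
  apply: continuousM; first exact: (@continuous_norm1 b).
  exact: (@cst_continuous _ _ _ b).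
exact: (continuous_max c1 c2).
Qed.

Lemma continuous_mnl_kernel j x : continuous (mnl_kernel j x).
Proof.
have cdot l : continuous (dotp x l).
  apply: continuous_big => [|k _ b]; first exact: add_continuous.
  exact: (cvgM (cvg_cst _) (@continuous_row_coord k b)).
have cexp l : continuous (fun b => expR (dotp x l b)).
  by move=> b; apply: continuous_comp; [exact: cdot|exact: continuous_expR].
have csum : continuous (fun b => \sum_(l < J) expR (dotp x l b)).
  by apply: continuous_big => [|l _]; [exact: add_continuous|exact: cexp].
have cinv : continuous (fun b => (\sum_(l < J) expR (dotp x l b))^-1).
  move=> b; apply: (cvgV _ (@csum b)).
  by rewrite gt_eqF// (sum_expR_gt0 j).
by move=> b; exact: (cvgM (@cexp j b) (@cinv b)).
Qed.

Lemma continuous_bumped_kernel n j x : continuous (bumped_kernel n j x).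
Proof.
by move=> b; exact: (cvgM (@continuous_bump n b) (@continuous_mnl_kernel j x b)).
Qed.

Lemma measurable_bumped_kernel n j x :
  measurable_fun [set: Beta R d] (bumped_kernel n j x : Beta R d -> R).
Proof. by apply: continuous_borel_measurable; exact: continuous_bumped_kernel. Qed.

Lemma measurable_bump n :
  measurable_fun [set: Beta R d] (bump n : Beta R d -> R).
Proof. by apply: continuous_borel_measurable; exact: continuous_bump. Qed.

Definition bq n j x G : R := \int[G]_b bumped_kernel n j x b.

Lemma integrable_bumped_kernel n j x G :
  G.-integrable setT (EFin \o (bumped_kernel n j x : Beta R d -> R)).
Proof.
apply: (@bounded_integrable _ _ _ G _ 1); first exact: measurable_bumped_kernel.
by move=> b; rewrite ger0_norm ?bumped_kernel_ge0 ?bumped_kernel_le1.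
Qed.

Lemma integrable_mnl_kernel j x G :
  G.-integrable setT (EFin \o (mnl_kernel j x : Beta R d -> R)).
Proof.
apply: (@bounded_integrable _ _ _ G _ 1); first exact: measurable_mnl_kernel.
by move=> b; rewrite ger0_norm ?mnl_kernel_le1// ltW// mnl_kernel_gt0.
Qed.

Lemma bq_le_q n j x G : bq n j x G <= q j x G.
Proof.
apply: le_Rintegral => //; first exact: integrable_bumped_kernel.
  exact: integrable_mnl_kernel.
by move=> b _; exact: bumped_kernel_le.
Qed.

(** Off the support of the cutoff both integrands vanish; on it each utility changes by at most h (n
    + 1), and [mnl_kernel_shift] doubles this. *)
Lemma bq_shift n j x y (h : R) G : 0 <= h -> (forall i k, `|x i k - y i k| <= h) ->
  expR (- (h * n.+1%:R + h * n.+1%:R)) * bq n j y G <= bq n j x G.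
Proof.
move=> h0 xy; rewrite /bq -RintegralZl//; last exact: integrable_bumped_kernel.
apply: le_Rintegral => //; [|exact: integrable_bumped_kernel|].
  exact: (integrableZl measurableT _ (integrable_bumped_kernel n j y G)).
move=> b _; rewrite /bumped_kernel.
have [bn|bn] := leP (norm1 b) n.+1%:R; last first.
  rewrite (_ : bump n b = 0) ?(mul0r, mulr0)//.
  by apply/max_idPl; rewrite subr_le0 ler_pdivlMr ?mul1r ?ltW// ltr0n.
rewrite mulrCA ler_wpM2l ?bump_ge0//; apply: mnl_kernel_shift => l.
rewrite /dotp -sumrB (le_trans (ler_norm_sum _ _ _))//.
apply: (@le_trans _ _ (\sum_(k < d) h * `|b ord0 k|)).
  by apply: ler_sum => k _; rewrite -mulrBl normrM ler_wpM2r.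
by rewrite -mulr_sumr ler_wpM2l.
Qed.

Lemma bump_cvg1 b : bump n b @[n --> \oo] --> (1 : R).
Proof.
apply: (@squeeze_cvgr _ _ _ _ (fun n => 1 - norm1 b / n.+1%:R) (fun=> 1)).
- by apply: nearW => n; rewrite bump_le1 andbT le_max lexx orbT.
- rewrite -[X in _ --> X](_ : 1 - norm1 b * 0 = 1); last by rewrite mulr0 subr0.
  apply: (cvgB (cvg_cst _)); apply: (cvgM (cvg_cst _)).
  exact: cvg_harmonic.
- exact: cvg_cst.
Qed.

(** The truncation error is at most the integral of 1 - [bump], as kernels are at most 1. This
    quantity involves neither j nor x, so one n serves them all. *)
Lemma q_le_bq G (eps : R) : is_prob G -> 0 < eps ->
  exists n, forall j x, q j x G <= bq n j x G + eps.
Proof.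
move=> G1 eps0.
have mb n : measurable_fun setT (fun b : Beta R d => 1 - bump n b).
  by apply: measurable_funB => //; exact: measurable_bump.
have b01 n b : `|1 - bump n b| <= 1.
  by rewrite ger0_norm ?subr_ge0 ?bump_le1// gerBl bump_ge0.
have ib n : G.-integrable setT (EFin \o (fun b : Beta R d => 1 - bump n b)).
  exact: (@bounded_integrable _ _ _ G _ 1).
have : \int[G]_b (1 - bump n b) @[n --> \oo] --> (0 : R).
  apply: fine_cvg.
  rewrite (_ : 0%:E = \int[G]_b (cst 0%E b))%E; last by rewrite integral0.
  apply: (@dominated_cvg _ _ _ G setT measurableT
    (fun n b => (1 - bump n b)%:E) (cst 0%E) (cst 1%E)).
  - by move=> n; apply/measurable_EFinP.
  - move=> b _; apply: cvg_EFin; first exact: nearW.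
    rewrite -[X in _ --> X](_ : 1 - 1 = 0); last by rewrite subrr.
    exact: (cvgB (cvg_cst _) (@bump_cvg1 b)).
  - by [].
  - exact: finite_measure_integrable_cst.
  - by move=> n b _; rewrite abse_EFin lee_fin.
move=> /cvgrPdist_lt/(_ _ eps0) => -[n _ /(_ n (leqnn n))] /=.
rewrite sub0r normrN => /(le_lt_trans (ler_norm _))/ltW hn.
exists n => j x.
rewrite (le_trans _ (lerD (lexx _) hn))// /bq -RintegralD//; last 1 first.
  exact: integrable_bumped_kernel.
apply: le_Rintegral => //; first exact: integrable_mnl_kernel.
  exact: (integrableD measurableT (integrable_bumped_kernel n j x G) (ib n)).
move=> b _; rewrite /bumped_kernel.
have := mnl_kernel_gt0 j x b; have := mnl_kernel_le1 j x b.
have := bump_le1 n b; have := bump_ge0 n b => h1 h2 h3 h4.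
have : 0 <= (1 - bump n b) * (1 - mnl_kernel j x b) by rewrite mulr_ge0// subr_ge0.
by lra.
Qed.

Lemma mnl_kernel_at0 j b : mnl_kernel j 0 b = J%:R^-1.
Proof.
have dot0 l : dotp (0 : 'M[R]_(J, d)) l b = 0.
  by rewrite /dotp big1// => k _; rewrite mxE mul0r.
rewrite mnl_kernelE; under eq_bigr do rewrite !dot0 subrr expR0.
by rewrite sumr_const card_ord.
Qed.

(** Comparison with x = 0, where every kernel is 1/J: the cutoff loses at most half of it, and
    moving from 0 to x costs the factor of [bq_shift] with h = C. *)
Lemma q_lower_bound G (C : R) : is_prob G -> 0 <= C ->
  exists2 c : R, 0 < c & forall j x, (forall i k, `|x i k| <= C) -> c <= q j x G.
Proof.
move=> G1 C0.
have [J0|J0] := posnP J.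
  by exists 1 => // j; exfalso; have := ltn_ord j; rewrite [X in (_ < X)%N]J0.
have J0' : 0 < J%:R^-1 :> R by rewrite invr_gt0 ltr0n.
have [n nP] := @q_le_bq G (J%:R^-1 / 2) G1 ltac:(by rewrite divr_gt0).
exists (expR (- (C * n.+1%:R + C * n.+1%:R)) * (J%:R^-1 / 2)).
  by rewrite mulr_gt0 ?expR_gt0// divr_gt0.
move=> j x xC; apply: le_trans (bq_le_q n j x G).
apply: le_trans (@bq_shift n j x 0 C G C0 _).
  rewrite ler_wpM2l ?expR_ge0//.
  have q0 : q j 0 G = J%:R^-1.
    rewrite /q; under eq_integral do rewrite mnl_kernel_at0.
    by rewrite integral_cst//= [X in (_ * X)%E]G1 mule1.
  have := nP j 0; rewrite q0; lra.
by move=> i k; rewrite mxE subr0.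
Qed.

Lemma weak_neighbourhood (X : set 'M[R]_(J, d)) (C : R)
    (G0 : giry (Beta R d) R) (Pi : giry (giry (Beta R d) R) R) (del : R) :
  0 < del -> 0 <= C -> (forall x, X x -> forall i k, `|x i k| <= C) ->
  is_prob G0 -> in_weak_support Pi G0 ->
  exists U : set (giry (Beta R d) R), [/\ measurable U, (0 < Pi U)%E &
    forall G, U G -> forall j x, X x -> expR (- del) * q j x G0 <= q j x G].
Proof.
move=> del0 C0 XC G01 supp.
have [c c0 cP] := q_lower_bound G01 C0.
pose u := expR (- (del / 4)).
have u0 : 0 < u by exact: expR_gt0.
have u1 : u < 1 by rewrite -expR0 ltr_expR oppr_lt0 divr_gt0.
(* Solves u - 2 s = u^3, so that two shifts and two additive errors amount to u^4 = exp(-del). *)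
pose s := (u - u ^+ 3) / 2.
have s0 : 0 < s.
  rewrite divr_gt0// subr_gt0 exprS -[ltRHS]mulr1 ltr_pM2l//.
  by rewrite exprn_ilt1// ltW.
have cs0 : 0 < c * s by rewrite mulr_gt0.
have [n nP] := q_le_bq G01 cs0.
(* The mesh for which 2 h (n + 1) = del / 4, so that one move to the grid costs exactly u. *)
pose h := del / (8 * n.+1%:R).
have h0 : 0 < h by rewrite divr_gt0// mulr_gt0// ltr0n.
have hn : expR (- (h * n.+1%:R + h * n.+1%:R)) = u.
  have : n.+1%:R != 0 :> R by rewrite pnatr_eq0.
  by rewrite /u /h; move: (n.+1%:R : R) => K K0; congr expR; field.
(* Entries shifted by C lie in [0, 2 C]; the successor makes room for the last cell. *)
pose N := (truncn (2 * C / h)).+1.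
pose T : finType := ('I_J * 'M['I_N]_(J, d))%type.
pose grid (m : 'M['I_N]_(J, d)) : 'M[R]_(J, d) := \matrix_(i, k) ((m i k)%:R * h - C).
have gridP x : X x -> exists m, forall i k, `|x i k - grid m i k| <= h.
  move=> Xx.
  pose m : 'M['I_N]_(J, d) := \matrix_(i, k) inord (truncn ((x i k + C) / h)).
  exists m => i k; have := XC x Xx i k; rewrite ler_norml => /andP[x1 x2].
  have xp : 0 <= (x i k + C) / h by rewrite divr_ge0// ?(ltW h0)//; lra.
  have /andP[t1 t2] := truncn_itv xp.
  rewrite !mxE inordK; last first.
    have c2 : 0 <= 2 * C / h by rewrite divr_ge0// ?(ltW h0)//; lra.
    have /andP[_ t3] := truncn_itv c2.
    rewrite -(ltr_nat R) (le_lt_trans t1)// (le_lt_trans _ t3)//.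
    by rewrite ler_pM2r ?invr_gt0//; lra.
  move: t1 t2; rewrite -natr1 ler_pdivlMr// ltr_pdivrMr// => t1 t2.
  by rewrite ler_norml; apply/andP; split; lra.
pose f (i : 'I_#|T|) : 'rV[R]_d -> R :=
  bumped_kernel n (enum_val i).1 (grid (enum_val i).2).
pose U := [set G : giry (Beta R d) R | is_prob G /\
       forall i, (`| fine (\int[G]_b (f i b)%:E)%E
                    - fine (\int[G0]_b (f i b)%:E)%E | < c * s)%R].
have PiU : (0 < Pi U)%E.
  apply: supp => //; first by move=> i; exact: continuous_bumped_kernel.
  move=> i; exists 1 => b.
  by rewrite ger0_norm ?bumped_kernel_ge0 ?bumped_kernel_le1.
exists U; split => //.
  rewrite (_ : U = [set G | is_prob G] `&` \bigcap_(i in [set: 'I_#|T|])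
     [set G : giry (Beta R d) R | `| fine (\int[G]_b (f i b)%:E)%E
                    - fine (\int[G0]_b (f i b)%:E)%E | < c * s]); last first.
    apply/seteqP; split => G [G1 H]; split => //.
      by move=> i _; exact: H.
    by move=> i; exact: H.
  apply: measurableI; first exact: measurable_is_prob.
  apply: fin_bigcap_measurable => // i _.
  have mfi : measurable_fun setT (fun G : giry (Beta R d) R =>
      `|fine (\int[G]_b (f i b)%:E)%E - fine (\int[G0]_b (f i b)%:E)%E|).
    apply: measurableT_comp => //; apply: measurable_funB => //.
    apply: (@measurableT_comp _ _ _ _ _ _ fine) => //.
    apply: (@measurable_giry_int _ (Beta R d) R (fun b => (f i b)%:E)).
      by apply/measurable_EFinP; exact: measurable_bumped_kernel.
    by move=> b; rewrite lee_fin bumped_kernel_ge0.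
  rewrite -[X in measurable X]setTI.
  have := mfi measurableT `]-oo, c * s[%classic (measurable_itv _).
  by congr measurable; apply/seteqP; split => G [_ H]; split => //; move: H; rewrite /= in_itv.
move=> G [G1 GU] j x Xx.
have [m mP] := gridP x Xx.
have mP' i k : `|grid m i k - x i k| <= h by rewrite distrC.
have := GU (enum_rank (j, m)); rewrite /f enum_rankK/= ltr_norml => /andP[g1 _].
rewrite -/(bq n j (grid m) G) -/(bq n j (grid m) G0) in g1.
have e1 := bq_shift n j G (ltW h0) mP; rewrite hn in e1.
have e2 := bq_shift n j G0 (ltW h0) mP'; rewrite hn in e2.
have e3 := nP j x.
have e4 := cP j x (XC x Xx).
have e5 := bq_le_q n j x G.
have -> : expR (- del) = u ^+ 4.
  by rewrite /u -expRM_natl; congr expR; field.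
have us : 2 * s = u - u ^+ 3 by rewrite /s mulrC divfK.
exact: weak_neighbourhood_arith u0 u1 s0 c0 us e4 e3 e2 g1 e1 e5.
Qed.

End neighbourhood.

Lemma compact_matrix_entries_bounded (R : realType) (m n : nat)
    (X : set 'M[R]_(m, n)) : compact X ->
  exists2 C : R, 0 <= C & forall x, X x -> forall i k, `|x i k| <= C.
Proof.
move=> cX.
have bd (p : 'I_m * 'I_n) : exists C : R, 0 <= C /\ forall x, X x -> `|x p.1 p.2| <= C.
  have ci : compact ((fun x : 'M[R]_(m, n) => x p.1 p.2) @` X).
    apply: continuous_compact => //.
    by apply: continuous_subspaceT; exact: coord_continuous.
  have [C [_ CP]] := compact_bounded ci.
  exists (`|C| + 1); split; first by rewrite addr_ge0.
  move=> x Xx; apply: CP; last by exists x.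
  by rewrite (le_lt_trans (ler_norm C))// ltrDl.
have [C CP] := choice bd.
exists (\sum_p C p); first by apply: sumr_ge0 => p _; have [] := CP p.
move=> x Xx i k; have [_ /(_ x Xx)] := CP (i, k).
move=> /le_trans; apply; rewrite (bigD1 (i, k))//= lerDl sumr_ge0// => p _.
by have [] := CP p.
Qed.

Lemma compact_borel_measurable (R : realType) (m n : nat)
    (X : set 'M[R]_(m, n)) :
  compact X -> measurable (X : set (borel 'M[R]_(m, n))).
Proof.
move=> cX; rewrite -[X]setCK; apply: measurableC; apply: sub_sigma_algebra.
by apply: closed_openC; apply: compact_closed => //; exact: norm_hausdorff.
Qed.

(** * Evidence and numerator along a fixed data path *)

Section posterior.
Context (R : realType) (J d : nat).
Context (dO : measure_display) (Omega : measurableType dO).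
Variables (P : probability Omega R) (M : probability (Cov R J d) R).
Variables (G0 : giry (Beta R d) R) (Pi : giry (giry (Beta R d) R) R).
Variables (Y : nat -> Omega -> 'I_J) (Z : nat -> Omega -> Cov R J d).
Hypothesis data : iid_mnl_data P M G0 Y Z.
Hypothesis G01 : is_prob G0.

(** The rectangles also prescribe the labels, so the law of the covariates is recovered by summing
    over j: the first i + 1 of them lie in X with probability 1. *)
Lemma ae_covariates_in (X : set (Cov R J d)) (j0 : 'I_J) :
  measurable X -> M X = 1%E -> {ae P, forall w, forall i, X (Z i w)}.
Proof.
move=> mX MX; have [mZ _ _] := data.
apply: ae_foralln => i.
have mE : measurable (Z i @^-1` X).
  by rewrite -[X in measurable X]setTI; exact: mZ.
have sumq : \sum_(j < J) \sum_(k < 1) 1 * fine (\int[M]_(x in X) (q j x G0)%:E)%E = 1.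
  under eq_bigr do rewrite big_ord1 mul1r.
  apply: EFin_inj; rewrite -sumEFin.
  under eq_bigr do rewrite fineK ?integral_q_fin//.
  rewrite -ge0_integral_sum//; last 2 first.
  - by move=> j; apply/measurable_EFinP/measurable_funTS; exact: measurable_q.
  - by move=> j x _; rewrite lee_fin q_ge0.
  under eq_integral do rewrite sumEFin (sum_q _ j0 G01).
  by rewrite integral_cst//= mul1e.
have := @integral_prod_simple _ _ _ _ _ _ _ _ _ _ data i.+1 1 (fun=> 1)
  (fun _ _ => X) (fun=> ler01) (fun _ _ => mX).
rewrite sumq expr1n => prod1.
have PE1 : (1 <= P (Z i @^-1` X))%E.
  rewrite -prod1 -[Z i @^-1` X]setIT -integral_indic//.
  apply: ge0_le_integral_weak => w _; rewrite ?lee_fin//.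
    by apply: prodr_ge0 => k _; rewrite big_ord1 mulr_ge0.
  split=> //; rewrite big_ord_recr/= big_ord1 mul1r.
  rewrite -[leRHS]mul1r ler_wpM2r//; apply: prodr_ile1 => k _.
  by rewrite big_ord1 mul1r indicE ler0n lern1 leq_b1.
have PC : (P (~` (Z i @^-1` X)) = 0)%E.
  rewrite probability_setC// (_ : P _ = 1%E) ?subee//.
  by apply/eqP; rewrite eq_le probability_le1.
exists (~` (Z i @^-1` X)); split => //.
exact: measurableC.
Qed.

(** For fixed data each factor is at most 1 / q(.; G0), a bound independent of G. Finiteness ensures
    that [fine] in the posterior does not default to 0. *)
Lemma lik_ratio_integral_fin n w :
  (\int[Pi]_G (lik_ratio G0 Y Z n w G)%:E)%E \is a fin_num.
Proof.
rewrite ge0_fin_numE; last first.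
  by apply: integral_ge0 => G _; rewrite lee_fin lik_ratio_ge0.
pose B := \prod_(i < n) (q (Y i w) (Z i w) G0)^-1.
apply: (@le_lt_trans _ _ (\int[Pi]_G (cst B%:E G))%E).
  apply: ge0_le_integral => //.
  - by move=> G _; rewrite lee_fin lik_ratio_ge0.
  - by apply/measurable_EFinP; exact: (measurable_lik_ratio data).
  - move=> G _; rewrite lee_fin; apply: ler_prod => i _.
    rewrite divr_ge0 ?q_ge0//= -[leRHS]mul1r ler_wpM2r ?q_le1//.
    by rewrite invr_ge0 q_ge0.
rewrite integral_cst//= lte_mul_pinfty//.
- by rewrite lee_fin prodr_ge0// => i _; rewrite invr_ge0 q_ge0.
- by rewrite (le_lt_trans (@sprobability_setT _ _ _ Pi))// ltry.
Qed.

Lemma evidence_lower_bound (U : set (giry (Beta R d) R)) (X : set (Cov R J d))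
    (del : R) n w : measurable U ->
  (forall G, U G -> forall j x, X x -> expR (- del) * q j x G0 <= q j x G) ->
  (forall i, X (Z i w)) ->
  expR (- del) ^+ n * fine (Pi U) <= fine (\int[Pi]_G (lik_ratio G0 Y Z n w G)%:E)%E.
Proof.
move=> mU UP wX.
rewrite -lee_fin fineK ?lik_ratio_integral_fin// EFinM fineK ?fin_num_measure//.
apply: (@le_trans _ _ (\int[Pi]_(G in U) (cst (expR (- del) ^+ n)%:E G))%E).
  by rewrite integral_cst.
apply: ge0_le_integral_weak => [G _|G _|G UG].
- by rewrite lee_fin exprn_ge0// expR_ge0.
- by rewrite lee_fin lik_ratio_ge0.
split=> //; rewrite lee_fin -{1}[n]card_ord -prodr_const.
apply: ler_prod => i _; rewrite expR_ge0/= ler_pdivlMr ?q_gt0//.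
exact: UP.
Qed.

(** A union bound: on A the integrand is dominated by the sum of its restrictions to the sets
    [D i]. *)
Lemma numerator_upper_bound (T : finType) (D : T -> set (giry (Beta R d) R))
    (A : set (giry (Beta R d) R)) (C : T -> R) (a : R) n w :
  (forall i, measurable (D i)) -> (forall G, A G -> exists i, D i G) ->
  (forall i, (\int[Pi]_(G in D i) (lik_ratio G0 Y Z n w G)%:E <= (C i * a)%:E)%E) ->
  fine (\int[Pi]_(G in A) (lik_ratio G0 Y Z n w G)%:E)%E <= (\sum_i C i) * a.
Proof.
move=> mD AD DC.
pose f G := (lik_ratio G0 Y Z n w G)%:E.
have f0 G : (0 <= f G)%E by rewrite lee_fin lik_ratio_ge0.
have mf : measurable_fun setT f.
  by apply/measurable_EFinP; exact: (measurable_lik_ratio data).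
have fD0 i G : (0 <= (f \_ (D i)) G)%E by rewrite patchE; case: ifP.
have le1 : (\int[Pi]_(G in A) f G <= ((\sum_i C i) * a)%:E)%E.
  apply: (@le_trans _ _ (\int[Pi]_G (\sum_i (f \_ (D i)) G))%E).
    apply: ge0_le_integral_weak => [//|G _|G AG]; first exact: sume_ge0.
    split=> //; have [i DG] := AD G AG.
    rewrite (bigD1 i)//= [X in (_ <= X + _)%E]patchE mem_set//.
    by apply: leeDl; apply: sume_ge0.
  rewrite ge0_integral_sum//; last first.
    move=> i; apply/(measurable_restrictT _ (mD i)).
    exact: measurable_funTS.
  rewrite mulr_suml -sumEFin lee_sum// => i _.
  by rewrite -integral_mkcond; exact: DC.
have int0 : (0 <= \int[Pi]_(G in A) f G)%E by exact: integral_ge0.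
rewrite -lee_fin fineK// ge0_fin_numE//.
exact: le_lt_trans le1 (ltry _).
Qed.

End posterior.

Theorem theorem1 (R : realType) (J d : nat) (hJ : (2 <= J)%N) (hd : (1 <= d)%N)
  (X : set (Cov R J d)) (M : probability (Cov R J d) R)
  (G0 : giry (Beta R d) R) (Pi : giry (giry (Beta R d) R) R)
  (dO : measure_display) (Omega : measurableType dO) (P : probability Omega R)
  (Ys : nat -> Omega -> 'I_J) (Xs : nat -> Omega -> Cov R J d) :
  compact (X : set 'M[R]_(J, d)) ->
  M X = 1%E ->
  is_prob G0 ->
  Pi [set: giry (Beta R d) R] = 1%E ->
  Pi [set G | is_prob G] = 1%E ->
  in_weak_support Pi G0 ->
  iid_mnl_data P M G0 Ys Xs ->
  (forall (j : 'I_J) (x : 'M[R]_(J, d)), X x -> 0 < q j x G0) ->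
  (\int[giry_join Pi]_b (enorm b)%:E < +oo)%E ->
  forall e : R, 0 < e ->
    {ae P, forall w,
       (fun n => posterior Pi G0 Ys Xs n w
                   [set G | is_prob G /\ qdist M X G G0 > e]) @ \oo --> 0}.
Proof.
move=> cX MX G01 _ _ supp data _ _ e e0.
have j0 : 'I_J by exists 0%N; exact: leq_trans hJ.
have mX : measurable X by exact: compact_borel_measurable.
have [C C0 XC] := compact_matrix_entries_bounded cX.
have [T [Phi [tPhi PhiP]]] := finite_tests M G01 j0 X e0.
(* The Chernoff bound asks for a gap at most 1; a smaller gap only enlarges the rejected sets. *)
pose eps := Num.min (e / 4) 1.
have eps0 : 0 < eps by rewrite lt_min ltr01 andbT divr_gt0.
have eps1 : eps <= 1 by rewrite ge_min lexx orbT.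
have epse : eps <= e / 4 by rewrite ge_min lexx.
(* Half of the numerator's exponent eps^2/32, so the ratio of the two rates is below 1. *)
pose del := eps ^+ 2 / 64.
have del0 : 0 < del by rewrite divr_gt0// exprn_gt0.
have [U [mU PiU UP]] := weak_neighbourhood del0 C0 XC G01 supp.
have p0 : 0 < fine (Pi U) by rewrite fine_gt0// PiU ltey_eq fin_num_measure.
pose D i := rejected M G0 (Phi i) eps.
have mD i : measurable (D i) by exact: measurable_rejected.
set A := [set G | _].
have AD G : A G -> exists i, D i G.
  move=> [G1 eG]; have [i [_ iG]] := PhiP G G1 eG; exists i; split => //.
  by rewrite (le_trans _ iG)// lerD2l.
have := ae_covariates_in data G01 j0 mX MX.
have := filter_forall (ae_filter_ringOfSetsType P)
  (fun i => rejected_numerator_bound Pi data G01 j0 (tPhi i) eps0 eps1).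
apply: filterS2 => w HD wX.
have [K KP] := choice HD.
pose r := expR (- (eps ^+ 2 / 32)); pose u := expR (- del).
have u0 : 0 < u by exact: expR_gt0.
apply: (@squeeze_cvgr _ _ _ _ (fun=> 0)
  (geometric (`|\sum_i K i| / fine (Pi U)) (r / u))).
- apply: nearW => n.
  have num0 : 0 <= fine (\int[Pi]_(G in A) (lik_ratio G0 Ys Xs n w G)%:E)%E.
    by rewrite fine_ge0// integral_ge0// => G _; rewrite lee_fin lik_ratio_ge0.
  have numle := numerator_upper_bound data G01 mD AD (fun i => KP i n).
  have denle := evidence_lower_bound Pi data G01 n mU UP wX.
  have low0 : 0 < u ^+ n * fine (Pi U) by rewrite mulr_gt0// exprn_gt0.
  rewrite /posterior divr_ge0//=; last exact: le_trans (ltW low0) denle.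
  apply: (@le_trans _ _ ((`|\sum_i K i| * r ^+ n) / (u ^+ n * fine (Pi U)))).
    apply: ler_pM => //.
    - by rewrite invr_ge0 (le_trans (ltW low0)).
    - rewrite (le_trans numle)// ler_wpM2r ?ler_norm// exprn_ge0// expR_ge0.
    - by rewrite lef_pV2// posrE// (lt_le_trans low0).
  by rewrite /geometric/= expr_div_n invfM [X in _ * X <= _]mulrC mulrACA.
- exact: cvg_cst.
- apply: cvg_geometric.
  rewrite ger0_norm ?divr_ge0 ?expR_ge0// ltr_pdivrMr// mul1r ltr_expR /del.
  by have : 0 < eps ^+ 2 by [exact: exprn_gt0]; lra.
Qed.
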